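(* Let $0<d\le\infty$ and let $\mu$ be a symmetric finite positive Borel measure on $(-d,d)$ with infinite support. Let $\{p_n\}_{n\ge0}$ be the orthonormal polynomials with respect to $\mu$, with leading coefficients $\gamma_n$. Let $r\ge0$ be an integer, $M_0,\dots,M_{2r+1}>0$, and let $\{q_n\}_{n\ge0}$ be the orthonormal polynomials with respect to $\langle p,q\rangle=\int p(x)q(x)\,d\mu(x)+\sum_{i=0}^{2r+1}M_i\,p^{(i)}(0)\,q^{(i)}(0)$. Let $\{a_n\},\{b_n\}$ be sequences of positive numbers with $$a_n^{-1/2}\cong A\,n^a,\qquad b_n\cong B\,n^b,$$ with real constants $a$ and $A,B,b>0$, and let $\nu>-1$ be such that $2a+1=2b(\nu+1)$. Suppose that $$\lim_n\,(-1)^n a_n^{1/2}\,p_{2n}\Big(\frac z{b_n}\Big)=z^{-\nu}J_\nu(2z),\qquad \lim_n\,(-1)^n a_n^{1/2}\,p_{2n+1}\Big(\frac z{b_n}\Big)=z^{-\nu}J_{\nu+1}(2z)$$ uniformly on compact subsets of $\mathbb{C}$, and that $$\lim_n\frac{\gamma_{2n}}{\gamma_{2n+1}}\,\frac{b_n}{n}=\frac1{2b},\qquad \lim_n\frac{\gamma_{2n+1}}{\gamma_{2n+2}}\,\frac{b_n}{n}=\frac1{2b}.$$ Then $$\lim_n\,(-1)^n a_n^{1/2}\,q_{2n}\Big(\frac z{b_n}\Big)=(-1)^{r+1}z^{-\nu}J_{\nu+2r+2}(2z),$$ $$\lim_n\,(-1)^n a_n^{1/2}\,q_{2n+1}\Big(\frac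 z{b_n}\Big)=(-1)^{r+1}z^{-\nu}J_{\nu+2r+3}(2z),$$ both uniformly on compact subsets of $\mathbb{C}$.
   Context: All moments of $\mu$ are finite; $\mu$ symmetric means it is invariant under $x\mapsto-x$. Orthonormal polynomials are normalized with positive leading coefficients, the $n$-th one having exact degree $n$. The notation $x_n\cong y_n$ means $x_n/y_n\to1$ as $n\to\infty$. $J_\nu(z)=\sum_{n=0}^\infty\frac{(-1)^n}{n!\,\Gamma(n+\nu+1)}\left(\frac z2\right)^{2n+\nu}$ is the Bessel function of order $\nu>-1$; the expressions $z^{-\nu}J_{\nu+m}(2z)=\sum_{n\ge0}\frac{(-1)^n z^{2n+m}}{n!\,\Gamma(n+\nu+m+1)}$ ($m\ge0$ an integer) are understood as entire functions of $z$. *)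

(* Defs.v *)
From HB Require Import structures.
From mathcomp Require Export all_boot all_order all_algebra.
From mathcomp Require Export complex.
From mathcomp Require Export all_classical all_reals all_analysis.

Set Implicit Arguments.
Unset Strict Implicit.
Unset Printing Implicit Defensive.

Export Order.TTheory GRing.Theory Num.Theory.
Export numFieldNormedType.Exports.

Local Open Scope classical_set_scope.
Local Open Scope ring_scope.
Local Open Scope complex_scope.

Definition finite_moments (R : realType)
    (mu : {finite_measure set (measurableTypeR R) -> \bar R}) : Prop :=
  forall k : nat, mu.-integrable setT (fun x : measurableTypeR R => (x ^+ k)%:E).

Definition symmetric_measure (R : realType)
    (mu : {finite_measure set (measurableTypeR R) -> \bar R}) : Prop :=
  forall A : set (measurableTypeR R), measurable A ->
    mu [set x : measurableTypeR R | A (- x)] = mu A.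

(* A measure on (-d, d), with d = +oo allowed, is a Borel measure on the line
   for which the complement of (-d, d) is null. *)
Definition carried_by_interval (R : realType) (d : \bar R)
    (mu : {finite_measure set (measurableTypeR R) -> \bar R}) : Prop :=
  mu (~` [set x : measurableTypeR R | (- d < x%:E < d)%E]) = 0%E.

Definition measure_support (R : realType)
    (mu : {finite_measure set (measurableTypeR R) -> \bar R}) : set R :=
  [set x : R | forall U : set R, open U -> U x -> (0 < mu U)%E].

Definition inner_mu (R : realType)
    (mu : {finite_measure set (measurableTypeR R) -> \bar R})
    (p q : {poly R}) : R :=
  \int[mu]_(x in setT) (p.[x] * q.[x]).

Definition inner_sobolev (R : realType)
    (mu : {finite_measure set (measurableTypeR R) -> \bar R})
    (N : nat) (M : 'I_N -> R) (p q : {poly R}) : R :=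
  inner_mu mu p q + \sum_(i < N) M i * p^`(i).[0] * q^`(i).[0].

Definition orthonormal_polynomials (R : realType)
    (ip : {poly R} -> {poly R} -> R) (p : nat -> {poly R}) : Prop :=
  [/\ forall n, size (p n) = n.+1,
      forall n, 0 < lead_coef (p n) &
      forall m n, ip (p m) (p n) = (m == n)%:R].

Definition asymp_equiv (R : realType) (x y : nat -> R) : Prop :=
  (fun n => x n / y n) @ \oo --> (1 : R).

Definition Gamma (R : realType) (s : R) : R :=
  \int[@lebesgue_measure R]_(t in `]0, +oo[) (t `^ (s - 1) * expR (- t)).

(* The entire function z^(-nu) J_(nu+m)(2z); for nu > -1 all the arguments of
   Gamma below are positive, so that the integral defining Gamma converges. *)
Definition scaled_bessel (R : realType) (nu : R) (m : nat) (z : R[i]) : R[i] :=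
  limn (series (fun n : nat =>
    ((-1) ^+ n * z ^+ (2 * n + m)
       / ((n`!)%:R * Gamma (n%:R + nu + m%:R + 1))%:C : R[i]^o))).

Definition poly_evalC (R : realType) (p : {poly R}) (z : R[i]) : R[i] :=
  (map_poly (real_complex R) p).[z].

(* The complex plane carries the topology of its norm through R[i]^o. *)
Definition cvg_uniform_on_compacts (R : realType)
    (f : nat -> R[i] -> R[i]) (g : R[i] -> R[i]) : Prop :=
  {family compact, (f : nat -> R[i]^o -> R[i]^o) @ \oo --> (g : R[i]^o -> R[i]^o)}.

Definition scaled_poly (R : realType) (a b : nat -> R) (p : nat -> {poly R})
    (n : nat) (z : R[i]) : R[i] :=
  ((-1) ^+ n * Num.sqrt (a n))%:C * poly_evalC (p n) (z / (b n)%:C).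

(* Main.v *)
(* By Cauchy's estimate (an average over roots of unity), locally uniform
   convergence of the rescaled polynomials amounts to convergence of every
   Taylor coefficient at 0 together with geometric bounds of arbitrarily small
   ratio; so everything is decided on real coefficients.

   By symmetry [p n] and [q n] have the parity of [n].  Put
   [c = lead_coef (q n) / lead_coef (p n)], [m i = M i * i!^2] and
   [K i j = \sum_(k <= n) p_(k,i) p_(k,j)].  Expanding [q n] in the [p k] gives
     [c q_(n,j) = p_(n,j) - \sum_i m i (c q_(n,i)) K i j] and
     [c^2 = 1 - \sum_i m i (c q_(n,i)) p_(n,i)].
   If [be j] denotes the limit of the rescaled [j]-th coefficient of one parity
   class, Stolz-Cesaro shows that the rescaled [K i j] behaves like
   [n be_i be_j / (2 b (th + i + j))] with [th = nu + e + 1], where [e] is the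
   parity.  The low coefficients of [q n] therefore solve a linear system that
   tends to one with a Cauchy matrix; hence [c --> 1], and by partial fractions
   the limit coefficients are
     [be j * \prod_(l <= r) (j - l) / (th + l + j)],
   which, by the functional equation of [Gamma], is [(-1)^(r+1)] times the
   Bessel coefficient of index [j - r - 1] and order raised by [2 r + 2]. *)

Require Import Defs.
From mathcomp Require Import measurable_realfun cyclic separable cyclotomic.
From mathcomp Require Import ring lra zify.

Set Implicit Arguments.
Unset Strict Implicit.
Unset Printing Implicit Defensive.

Local Open Scope classical_set_scope.
Local Open Scope ring_scope.
Local Open Scope complex_scope.

(** * Limits of real sequences: finite sums and eventual equality *)

Lemma cvgn_sum (R : realType) I (r : seq I) (P : pred I)
    (f : I -> nat -> R) (l : I -> R) :
  (forall i, P i -> f i @ \oo --> l i) ->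
  (fun n => \sum_(i <- r | P i) f i n) @ \oo --> \sum_(i <- r | P i) l i.
Proof.
move=> fl; elim: r => [|i r IH].
  rewrite big_nil (_ : (fun _ => _) = cst 0); first exact: cvg_cst.
  by apply/funext => n; rewrite big_nil.
rewrite big_cons (_ : (fun _ => _) = (fun n =>
    if P i then f i n + \sum_(j <- r | P j) f j n else \sum_(j <- r | P j) f j n)).
  by case: ifPn => // Pi; apply: cvgD => //; exact: fl.
by apply/funext => n; rewrite big_cons.
Qed.

Lemma near_eq_cvgn (R : realType) (f g : nat -> R) (l : R) :
  (\forall n \near \oo, f n = g n) -> f @ \oo --> l -> g @ \oo --> l.
Proof. by move=> fg; apply: cvg_trans; exact: near_eq_cvg. Qed.

(** * Locally uniform convergence and power series in the complex plane *)

Section complex_plane.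
Variable R : realType.
Implicit Types (x y e rho : R) (z w : R[i]).

Lemma normC_real x : `|x%:C| = `|x|%:C :> R[i].
Proof. by rewrite normc_def /= expr0n addr0 sqrtr_sqr. Qed.

Lemma normC_le_Re_Im z : `|z| <= (`|complex.Re z| + `|complex.Im z|)%:C.
Proof.
rewrite normc_def lecR -[leRHS]ger0_norm ?addr_ge0// -sqrtr_sqr.
rewrite ler_sqrt ?sqr_ge0// sqrrD !real_normK ?num_real//.
by rewrite -addrA lerD2l lerDr mulrn_wge0 // mulr_ge0.
Qed.

Lemma Im_le_normC z : `|complex.Im z|%:C <= `|z|.
Proof.
by rewrite normc_def lecR -sqrtr_sqr ler_sqrt ?addr_ge0 ?sqr_ge0// lerDr sqr_ge0.
Qed.

(** The order of [R[i]] compares only numbers with equal imaginary parts, so the radii of its balls,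
    formally complex, are in fact real. *)
Lemma gt0_realC (c : R[i]) : 0 < c -> exists2 e, 0 < e & c = e%:C.
Proof.
case: c => a b; rewrite ltcE /= => /andP[/eqP -> a0].
by exists a.
Qed.

Lemma real_pair_continuous :
  continuous (fun p : R * R => (p.1 +i* p.2 : R[i]^o)).
Proof.
move=> [x y]; apply/cvgrPdist_lt => c /gt0_realC[e e0 ->{c}].
have e20 : 0 < e / 2 by rewrite divr_gt0.
exists (ball x (e / 2), ball y (e / 2)).
  by split; exact: nbhsx_ballx.
move=> [x' y'] [/=]; rewrite /ball /= => xx' yy'.
apply: le_lt_trans (normC_le_Re_Im _) _.
by rewrite ltcR /= [ltRHS]splitr ltrD.
Qed.

Lemma compact_box rho :
  compact ((fun p : R * R => (p.1 +i* p.2 : R[i]^o)) @`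
           (`[- rho, rho] `*` `[- rho, rho])).
Proof.
apply: continuous_compact.
  exact/continuous_subspaceT/real_pair_continuous.
by apply: compact_setX; exact: segment_compact.
Qed.

Lemma compact_normC_bounded (A : set R[i]^o) : compact A ->
  exists rho, forall z, A z -> `|z| <= rho%:C.
Proof.
move=> cA.
have cn : continuous (fun z : R[i]^o => complex.Re `|z|).
  move=> z V /nbhs_ballP[e /= e0 eV].
  have e0C : 0 < e%:C :> R[i] by rewrite ltcR.
  have := nbhsx_ballx (z : R[i]^o) e%:C e0C; apply: filterS => w zw.
  apply: eV; rewrite -ball_normE /= -ltcR (le_lt_trans _ zw)//.
  apply: le_trans (ler_dist_dist _ _).
  rewrite !(normc_def z) !(normc_def w) -(rmorphB (real_complex R)) normC_real lecR.
  by case: (z) (w) => a b [c d] /=.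
have /compact_bounded[M [Mr MA]] := continuous_compact (continuous_subspaceT cn) cA.
exists (M + 1) => z Az.
have M1 : M < M + 1 by rewrite ltrDl.
have /= := MA _ M1 (complex.Re `|z|) (ex_intro2 _ _ z Az erefl).
by rewrite (normc_def z) lecR; apply: le_trans; case: (z) => a b; exact: ler_norm.
Qed.

(** Every disc lies in a compact box and every compact set lies in a disc, so compact convergence
    reduces to an epsilon statement on discs, the only form used below. *)
Lemma cvg_uniform_on_discsP (f : nat -> R[i] -> R[i]) (g : R[i] -> R[i]) :
  cvg_uniform_on_compacts f g <->
  forall rho e, 0 < e ->
    \forall n \near \oo, forall z, `|z| <= rho%:C -> `|f n z - g z| <= e%:C.
Proof.
split.
- move=> /fam_cvgP fg rho e e0.
  have := fg _ (@compact_box rho).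
  have e0C : 0 < e%:C :> R[i] by rewrite ltcR.
  move=> /(_ [set h | forall z, `|z| <= rho%:C -> `|h z - g z| <= e%:C]); apply.
  apply/uniform_nbhs; exists [set xy | ball xy.1 e%:C xy.2]; split.
    exact: (entourage_ball (R[i]^o : pseudoMetricType R[i]) (PosNum e0C)).
  move=> h /= hg z zrho; rewrite distrC ltW//; apply: hg.
  exists (complex.Re z, complex.Im z); last by case: z {zrho}.
  split => /=; rewrite in_itv /= -ler_norml -lecR.
    exact: le_trans (normc_ge_Re z) _.
  exact: le_trans (Im_le_normC z) _.
- move=> fg; apply/fam_cvgP => A /compact_normC_bounded[rho Arho] P.
  move=> /uniform_nbhs[E [entE EP]].
  move: entE; rewrite -(@entourage_ballE _ (R[i]^o : pseudoMetricType R[i])).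
  move=> [c /= /gt0_realC[e e0 ->] eE].
  have e20 : 0 < e / 2 by rewrite divr_gt0.
  have := fg rho (e / 2) e20; apply: filterS => n fgn; apply: EP => z /Arho zrho.
  apply: eE => /=; rewrite /ball /= distrC (le_lt_trans (fgn _ zrho))// ltcR.
  by rewrite ltr_pdivrMr// ltr_pMr// ltr1n.
Qed.

End complex_plane.

(** * Roots of unity and Cauchy's estimate *)

(** In characteristic 0 the polynomial ['X^n - 1] is separable, so it has [n] distinct roots, and a
    full set of [n]-th roots of unity contains a primitive one. *)
Lemma closed_field_prim_root (C : numClosedFieldType) n : (0 < n)%N ->
  exists w : C, n.-primitive_root w.
Proof.
move=> n0; have [s Ds] := closed_field_poly_normal ('X^n - 1 : {poly C}).
have mon : ('X^n - 1 : {poly C}) \is monic by apply: monicXnsubC.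
rewrite (monicP mon) scale1r in Ds.
have us : uniq s.
  rewrite -separable_prod_XsubC -Ds separable_Xn_sub_1// pnatr_eq0 -lt0n//.
have ss : size s = n.
  apply: succn_inj; rewrite -(size_prod_XsubC s id) -Ds size_XnsubC//.
have sr : all n.-unity_root s.
  by apply/allP => w ws; rewrite /root_of_unity Ds root_prod_XsubC.
have /hasP[w _ pw] : has n.-primitive_root s by rewrite has_prim_root ?ss.
by exists w.
Qed.

Lemma sum_prim_root_expr (C : fieldType) n (w : C) m :
  n.-primitive_root w -> \sum_(k < n) (w ^+ m) ^+ k = (n %| m)%:R * n%:R.
Proof.
move=> pw; have [nm|nm] := boolP (n %| m)%N.
  have /eqP -> : w ^+ m == 1 by rewrite -(prim_order_dvd pw).
  under eq_bigr do rewrite expr1n.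
  by rewrite sumr_const card_ord mul1r.
rewrite mul0r; apply/eqP.
have : (w ^+ m - 1) * \sum_(k < n) (w ^+ m) ^+ k == 0.
  by rewrite -subrX1 -exprM mulnC exprM (prim_expr_order pw) expr1n subrr.
by rewrite mulf_eq0 subr_eq0 -(prim_order_dvd pw) (negbTE nm).
Qed.

(* Averaging [P (rho w^k) w^(-jk)] over the powers of a primitive root of unity
   of order larger than the degree of [P] isolates the [j]-th coefficient. *)
Lemma coef_cauchy_estimate (C : numClosedFieldType) (P : {poly C}) (rho M : C) j :
  0 <= rho -> (forall z, `|z| = rho -> `|P.[z]| <= M) ->
  `|P`_j| * rho ^+ j <= M.
Proof.
move=> rho0 PM.
have M0 : 0 <= M by apply: le_trans (PM rho _); rewrite ?normr_ge0 ?ger0_norm.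
have [jP|Pj] := ltnP j (size P); last by rewrite nth_default// normr0 mul0r.
set n := size P in jP *.
have n0 : (0 < n)%N by exact: leq_ltn_trans jP.
have [w pw] := closed_field_prim_root C n0.
have w1 : `|w| = 1.
  by apply/eqP; rewrite -(pexpr_eq1 n0)// -normrX (prim_expr_order pw) normr1.
have wk k : `|w ^+ k| = 1 by rewrite normrX w1 expr1n.
have key : n%:R * (P`_j * rho ^+ j)
    = \sum_(k < n) P.[rho * w ^+ k] * (w ^+ (n - j)) ^+ k.
  under eq_bigr => k _ do rewrite horner_coef mulr_suml -/n.
  rewrite exchange_big /= (bigD1 (Ordinal jP)) //= [X in _ = _ + X]big1 ?addr0.
    rewrite (eq_bigr (fun k : 'I_n => P`_j * rho ^+ j)).
      by rewrite sumr_const card_ord mulr_natl.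
    move=> k _; rewrite exprMn -[RHS]mulr1 -!mulrA; congr (_ * (_ * _)).
    rewrite [w ^+ k ^+ j]exprAC -(@exprMn C) -exprD subnKC 1?ltnW//.
    by rewrite (prim_expr_order pw) expr1n.
  move=> i ij.
  rewrite (eq_bigr (fun k : 'I_n => P`_i * rho ^+ i * (w ^+ (i + (n - j))) ^+ k)).
    rewrite -mulr_sumr sum_prim_root_expr//.
    suff -> : (n %| i + (n - j))%N = false by rewrite mul0r mulr0.
    (* Since [i] and [j] are below [n], the exponent [i + (n - j)] lies strictly between 0 and [2n];
       it is a multiple of [n] only for [i = j]. *)
    apply/negbTE; apply: contraNN ij => nij; apply/eqP/val_inj => /=.
    have := ltn_ord i; rewrite -/n => iN.
    have [q /eqP] := dvdnP nij; case: q => [|[|q]]; rewrite ?mul0n ?mul1n; lia.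
  move=> k _; rewrite exprMn -!mulrA; congr (_ * (_ * _)).
  by rewrite [w ^+ k ^+ i]exprAC -(@exprMn C) -exprD.
rewrite -(ler_pM2l (x := n%:R)) ?ltr0n//.
rewrite -[X in _ * (_ * X)]ger0_norm ?exprn_ge0// -normrM -[X in X * _]ger0_norm
  ?ler0n// -normrM key.
apply: le_trans (ler_norm_sum _ _ _) _.
rewrite mulr_natl -[X in _ *+ X]card_ord -sumr_const; apply: ler_sum => k _.
rewrite normrM -exprM wk mulr1; apply: PM.
by rewrite normrM wk mulr1 ger0_norm.
Qed.

(** * Complex series dominated by a geometric series of ratio 1/2 *)

Section dominated_series.
Variable R : realType.
Implicit Types (K rho e : R) (c : nat -> R) (z : R[i]).

Lemma sum_half_expr (S T : nat) : (T <= S)%N ->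
  \sum_(T <= n < S) (2^-1 : R) ^+ n = 2 * 2^-1 ^+ T - 2 * 2^-1 ^+ S.
Proof.
elim: S => [|S IH]; first by rewrite leqn0 => /eqP->; rewrite big_geq// subrr.
rewrite leq_eqVlt => /predU1P[->|TS]; first by rewrite big_geq// subrr.
by rewrite big_nat_recr//= IH// exprS; field.
Qed.

Lemma norm_sum_half_le (u : nat -> R[i]) K (S T : nat) :
  (forall n, `|u n| <= (K * 2^-1 ^+ n)%:C) ->
  `|\sum_(T <= n < S) u n| <= (2 * K * 2^-1 ^+ T)%:C.
Proof.
move=> uK.
have K0 : 0 <= K by have := uK 0%N; rewrite expr0 mulr1 -ler0c; exact: le_trans.
have [ST|TS] := leqP S T.
  by rewrite big_geq// normr0 ler0c !mulr_ge0// exprn_ge0.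
apply: le_trans (ler_norm_sum _ _ _) _.
apply: le_trans (ler_sum _ (fun n _ => uK n)) _.
rewrite -rmorph_sum /= lecR -mulr_sumr sum_half_expr 1?ltnW// -mulrA mulrCA.
rewrite ler_wpM2l// -subr_ge0.
by rewrite (_ : _ - _ = 2 * (2^-1)^+S) ?mulr_ge0 ?exprn_ge0//; ring.
Qed.

Lemma geometric_half_cvg (u : R^nat) K :
  (forall n, `|u n| <= K * 2^-1 ^+ n) -> cvgn (series u).
Proof.
move=> uK; apply: normed_cvg.
apply: (@series_le_cvg _ _ (geometric K 2^-1)) => //=.
- by move=> n; exact: le_trans (uK n).
- by apply: is_cvg_geometric_series; rewrite ger0_norm// invf_lt1// ltr1n.
Qed.

(** Real and imaginary parts converge absolutely, and pairing them is continuous. The tail bound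
    depends on [K] only, hence is uniform wherever [K] is. *)
Lemma complex_series_cvg (u : nat -> R[i]) K :
  (forall n, `|u n| <= (K * 2^-1 ^+ n)%:C) ->
  exists2 l : R[i], series u @ \oo --> (l : R[i]^o) &
    forall T, `|l - \sum_(0 <= n < T) u n| <= (2 * K * 2^-1 ^+ T)%:C.
Proof.
move=> uK.
have cRe : cvgn (series (@complex.Re R \o u)).
  apply: (geometric_half_cvg (K := K)) => n.
  by rewrite -lecR; exact: le_trans (normc_ge_Re _) (uK n).
have cIm : cvgn (series (@complex.Im R \o u)).
  apply: (geometric_half_cvg (K := K)) => n.
  by rewrite -lecR; exact: le_trans (Im_le_normC _) (uK n).
have sE : series u = (fun p : R * R => (p.1 +i* p.2 : R[i])) \o
     (fun n => (series (@complex.Re R \o u) n, series (@complex.Im R \o u) n)).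
  apply/funext => n /=; rewrite /series/=; elim: n => [|n IH].
    by rewrite !big_geq.
  by rewrite !big_nat_recr//= IH; case: (u n) => a b; simpc.
pose l := limn (series (@complex.Re R \o u)) +i* limn (series (@complex.Im R \o u)).
have ul : series u @ \oo --> (l : R[i]^o).
  rewrite sE.
  exact: (cvg_comp _ _ (cvg_pair cRe cIm) (@real_pair_continuous R (_, _))).
exists l => // T.
set b := 2 * K * _.
have rE : `|l - \sum_(0 <= n < T) u n|
          = (complex.Re `|l - \sum_(0 <= n < T) u n|)%:C.
  by rewrite normc_def.
(* The bound passes to the limit with an arbitrary loss [e], through a partial sum that is [e]-close
   to [l] and has index at least [T]. *)
rewrite rE lecR; apply/ler_addgt0Pr => e e0; rewrite -lecR -rE.
have e0C : 0 < e%:C :> R[i] by rewrite ltcR.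
have [N _ /(_ (maxn N T)) /=] := ul _ (nbhsx_ballx (l : R[i]^o) e%:C e0C).
rewrite leq_maxl -ball_normE /= => /(_ isT) /ltW lN.
set sN := series u _ in lN.
have -> : l - \sum_(0 <= n < T) u n = (l - sN) + (sN - \sum_(0 <= n < T) u n).
  by rewrite addrA subrK.
apply: le_trans (ler_normD _ _) _; rewrite [b + e]addrC rmorphD; apply: lerD => //.
rewrite /sN /series/= (big_cat_nat (leq0n T) (leq_maxr N T))/= [X in X - _]addrC addrK.
exact: norm_sum_half_le.
Qed.

End dominated_series.

(** * Locally uniform convergence read on Taylor coefficients *)

Section coefficientwise.
Variable R : realType.
Implicit Types (K rho e : R) (c : nat -> R) (z : R[i]) (F : nat -> {poly R}).

Lemma realC0 : 0%:C = 0 :> R[i]. Proof. by []. Qed.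

(** Equivalent to an infinite radius of convergence, in the form of the bounds that Cauchy's
    estimate yields. *)
Definition rapidly_decreasing c :=
  forall rho, 1 <= rho -> exists K, forall j, `|c j| * rho ^+ j <= K.

Definition power_sum c m z : R[i] :=
  limn (series (fun n => (c n)%:C * z ^+ (2 * n + m) : R[i]^o)).

(** In [2 * rho ^+ 2] the square pays for the exponent [2 * n], and the factor 2 leaves a spare
    [2^-1 ^+ n] that makes the terms summable. *)
Lemma power_term_le K rho x n m z : 1 <= rho -> `|z| <= rho%:C ->
  `|x| * (2 * rho ^+ 2) ^+ n <= K ->
  `|x%:C * z ^+ (2 * n + m)| <= (K * rho ^+ m * 2^-1 ^+ n)%:C.
Proof.
move=> rho1 zrho xK; have rho0 : 0 <= rho by exact: le_trans rho1.
rewrite normrM normC_real normrX.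
apply: (@le_trans _ _ (`|x| * rho ^+ (2 * n + m))%:C).
  rewrite rmorphM ler_wpM2l ?ler0c// rmorphXn.
  by rewrite lerXn2r // ?nnegrE ?ler0c.
rewrite lecR.
have -> : `|x| * rho ^+ (2 * n + m) = `|x| * (2 * rho ^+ 2) ^+ n * rho ^+ m * 2^-1 ^+ n.
  by rewrite exprMn exprD exprM exprVn; field; rewrite expf_neq0// pnatr_eq0.
by rewrite !ler_wpM2r ?exprn_ge0.
Qed.

Lemma power_sum_tail c rho m : rapidly_decreasing c -> 1 <= rho ->
  exists K, forall z, `|z| <= rho%:C ->
    series (fun n => (c n)%:C * z ^+ (2 * n + m)) @ \oo -->
      (power_sum c m z : R[i]^o) /\
    forall T, `|power_sum c m z - \sum_(0 <= n < T) (c n)%:C * z ^+ (2 * n + m)|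
      <= (K * 2^-1 ^+ T)%:C.
Proof.
move=> cr rho1; have [|K cK] := cr (2 * rho ^+ 2).
  by rewrite mulr_ege1 ?ler1n ?exprn_ege1.
exists (2 * (K * rho ^+ m)) => z zrho.
have [l ul lT] := complex_series_cvg (fun n => power_term_le m rho1 zrho (cK n)).
suff -> : power_sum c m z = l by [].
exact: (@cvg_lim _ (@norm_hausdorff _ (R[i]^o : normedModType R[i]))).
Qed.

Lemma half_expr_cvg0 K e : 0 < e -> \forall T \near \oo, K * 2^-1 ^+ T <= e.
Proof.
move=> e0; have : geometric K 2^-1 @ \oo --> (0 : R).
  by apply: cvg_geometric; rewrite ger0_norm// invf_lt1// ltr1n.
move=> /cvgrPdist_le /(_ _ e0); apply: filterS => T /=.
by rewrite sub0r normrN; apply: le_trans; exact: ler_norm.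
Qed.

Lemma coef_poly_evalC_le (p : {poly R}) rho K k : 0 <= rho ->
  (forall z, `|z| <= rho%:C -> `|poly_evalC p z| <= K%:C) ->
  `|p`_k| * rho ^+ k <= K.
Proof.
move=> rho0 pK; rewrite -lecR rmorphM rmorphXn /= -normC_real.
have := @coef_cauchy_estimate R[i] (map_poly (real_complex R) p) rho%:C K%:C k.
rewrite coef_map ler0c; apply => // z zr; apply: pK.
by rewrite zr.
Qed.

(** Cauchy's estimate on the unit circle is applied to [F n] minus a Taylor polynomial of the limit.
    Truncating at [T > j] keeps the [j]-th coefficient, and the difference is small on the unit
    disc. *)
Lemma coef_cvg_of_uniform F c m : rapidly_decreasing c ->
  cvg_uniform_on_compacts (fun n => poly_evalC (F n)) (power_sum c m) ->
  forall j, (fun n => (F n)`_(2 * j + m)) @ \oo --> c j.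
Proof.
move=> cr /cvg_uniform_on_discsP Fc j; apply/cvgrPdist_le => e e0.
have e20 : 0 < e / 2 by rewrite divr_gt0.
have [K cK] := power_sum_tail m cr (lexx 1).
have [T jT TK] : exists2 T, (j < T)%N & K * 2^-1 ^+ T <= e / 2.
  have [N _ NK] := half_expr_cvg0 K e20.
  exists (maxn N j.+1); first exact: leq_maxr.
  by apply: NK; exact: leq_maxl.
have := Fc 1 (e / 2) e20; apply: filterS => n Fn.
pose D := F n - \sum_(0 <= k < T) c k *: 'X^(2 * k + m).
have -> : c j - (F n)`_(2 * j + m) = - D`_(2 * j + m).
  rewrite coefB opprB; congr (_ - _); rewrite coef_sum big_mkord.
  rewrite (bigD1 (Ordinal jT))//= coefZ coefXn eqxx mulr1 big1 ?addr0// => i ij.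
  rewrite coefZ coefXn (_ : (_ == _) = false) ?mulr0//.
  apply: contraNF ij => /eqP ij; apply/eqP/val_inj => /=; lia.
rewrite normrN -[X in X <= _]mulr1 -(expr1n _ (2 * j + m)).
apply: coef_poly_evalC_le => // z z1.
have [_ /(_ T)] := cK z z1; set gT := \sum_(_ <= _ < _) _ => gz.
have -> : poly_evalC D z
    = (poly_evalC (F n) z - power_sum c m z) + (power_sum c m z - gT).
  rewrite addrA subrK /poly_evalC rmorphB /= hornerD hornerN; congr (_ - _).
  rewrite rmorph_sum /= horner_sum; apply: eq_bigr => k _.
  by rewrite map_polyZ /= map_polyXn hornerZ hornerXn.
apply: le_trans (ler_normD _ _) _; rewrite (splitr e) rmorphD; apply: lerD.
  exact: Fn.
by apply: le_trans gz _; rewrite lecR.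
Qed.

(** Cauchy's estimate on the circle of radius [rho] settles all large [n]; the sums [S n] absorb the
    finitely many others. The bound must hold for every [n] because the kernel sums later involve
    all indices up to [N]. *)
Lemma coef_bound_of_uniform F c m rho : rapidly_decreasing c -> 1 <= rho ->
  cvg_uniform_on_compacts (fun n => poly_evalC (F n)) (power_sum c m) ->
  exists K, forall n j, `|(F n)`_(2 * j + m)| * rho ^+ j <= K.
Proof.
move=> cr rho1 /cvg_uniform_on_discsP Fc; have rho0 : 0 <= rho by exact: le_trans rho1.
have [K cK] := power_sum_tail m cr rho1.
have [N _ NF] := Fc rho 1 ltr01.
have rho_le j : rho ^+ j <= rho ^+ (2 * j + m) by rewrite ler_weXn2l//; lia.
pose S n := \sum_(k < size (F n)) `|(F n)`_k| * rho ^+ k.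
have S0 n : 0 <= S n by rewrite sumr_ge0// => k _; rewrite mulr_ge0// exprn_ge0.
have K0 : 0 <= K.
  have [] := cK 0; first by rewrite normr0 ler0c.
  move=> _ /(_ 0%N); rewrite expr0 mulr1 => H.
  by rewrite -ler0c; exact: le_trans H.
exists (\sum_(n < N) S n + (1 + K)) => n j.
apply: (@le_trans _ _ (`|(F n)`_(2 * j + m)| * rho ^+ (2 * j + m))).
  by rewrite ler_wpM2l.
have [nN|Nn] := ltnP n N.
  apply: (@le_trans _ _ (S n)); last first.
    rewrite (bigD1 (Ordinal nN))//= -addrA lerDl addr_ge0 ?addr_ge0//.
    by rewrite sumr_ge0.
  have [kF|Fk] := ltnP (2 * j + m) (size (F n)); last first.
    by rewrite nth_default// normr0 mul0r.
  rewrite /S (bigD1 (Ordinal kF))//= lerDl sumr_ge0// => k _.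
  by rewrite mulr_ge0// exprn_ge0.
apply: (@le_trans _ _ (1 + K)); last by rewrite lerDr sumr_ge0.
apply: coef_poly_evalC_le => // z zr.
have -> : poly_evalC (F n) z = (poly_evalC (F n) z - power_sum c m z) + power_sum c m z.
  by rewrite subrK.
apply: le_trans (ler_normD _ _) _; rewrite rmorphD; apply: lerD.
  exact: NF.
by have [_ /(_ 0%N)] := cK z zr; rewrite big_geq// subr0 expr0 mulr1.
Qed.

Lemma poly_evalC_parity (p : {poly R}) m z :
  (forall k, (k < m)%N || (odd k != odd m) -> p`_k = 0) ->
  poly_evalC p z = \sum_(0 <= j < size p) (p`_(2 * j + m))%:C * z ^+ (2 * j + m).
Proof.
move=> pm; rewrite /poly_evalC (horner_coef_wide (n := 2 * size p + m)); last first.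
  by apply: leq_trans (size_poly _ _) _; lia.
have sumE (f : nat -> R[i]) S : (forall k, (k < m)%N || (odd k != odd m) -> f k = 0) ->
    \sum_(k < 2 * S + m) f k = \sum_(0 <= j < S) f (2 * j + m)%N.
  move=> f0; elim: S => [|S IH].
    by rewrite muln0 add0n big_geq// big1// => k _; rewrite f0// ltn_ord.
  rewrite big_nat_recr//= -IH mulnS add2n !addSn !big_ord_recr /= (f0 (2 * S + m).+1)
    ?addr0//.
  by rewrite /= oddD oddM /=; case: odd; rewrite orbT.
rewrite (sumE (fun k => (map_poly (real_complex R) p)`_k * z ^+ k)).
  by apply: eq_bigr => j _; rewrite coef_map.
by move=> k km; rewrite coef_map (pm k km) /= realC0 mul0r.
Qed.

(** Tannery's argument: after a cut at [T], the head converges coefficient by coefficient, and the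
    tails of [F n] and of the limit are both dominated by a geometric series. *)
Lemma uniform_of_coef_cvg F c m :
  (forall n k, (k < m)%N || (odd k != odd m) -> (F n)`_k = 0) ->
  rapidly_decreasing c ->
  (forall j, (fun n => (F n)`_(2 * j + m)) @ \oo --> c j) ->
  (forall rho, 1 <= rho -> exists K, \forall n \near \oo,
     forall j, `|(F n)`_(2 * j + m)| * rho ^+ j <= K) ->
  cvg_uniform_on_compacts (fun n => poly_evalC (F n)) (power_sum c m).
Proof.
move=> Fm cr Fc Fb; apply/cvg_uniform_on_discsP => rho0 e e0.
pose rho := Num.max 1 rho0.
have rho1 : 1 <= rho by rewrite le_max lexx.
have [K cK] := power_sum_tail m cr rho1.
have [|K' FK'] := Fb (2 * rho ^+ 2); first by rewrite mulr_ege1 ?ler1n ?exprn_ege1.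
have e30 : 0 < e / 3 by rewrite divr_gt0.
have [T [TK TK']] : exists T,
    K * 2^-1 ^+ T <= e / 3 /\ 2 * (K' * rho ^+ m) * 2^-1 ^+ T <= e / 3.
  have [N _ NK] := half_expr_cvg0 K e30.
  have [N' _ NK'] := half_expr_cvg0 (2 * (K' * rho ^+ m)) e30.
  exists (maxn N N'); split; [apply: NK|apply: NK'] => /=; lia.
have sum0 : \forall n \near \oo,
    \sum_(0 <= j < T) `|(F n)`_(2 * j + m) - c j| * rho ^+ (2 * j + m) <= e / 3.
  have : (fun n => \sum_(0 <= j < T) `|(F n)`_(2 * j + m) - c j| * rho ^+ (2 * j + m))
      @ \oo --> \sum_(0 <= j < T) `|c j - c j| * rho ^+ (2 * j + m).
    apply: cvgn_sum => j _; apply: cvgMl; apply: cvg_norm.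
    by apply: cvgB; [exact: Fc|exact: cvg_cst].
  move=> /cvgrPdist_le /(_ _ e30); apply: filterS => n.
  rewrite [X in X - _]big1 ?sub0r ?normrN; last first.
    by move=> j _; rewrite subrr normr0 mul0r.
  by apply: le_trans; exact: ler_norm.
near=> n => z zr0.
have zr : `|z| <= rho%:C by apply: le_trans zr0 _; rewrite lecR le_max lexx orbT.
have FnK' : forall j, `|(F n)`_(2 * j + m)| * (2 * rho ^+ 2) ^+ j <= K' by near: n.
have sn : \sum_(0 <= j < T) `|(F n)`_(2 * j + m) - c j| * rho ^+ (2 * j + m) <= e / 3.
  by near: n.
rewrite (poly_evalC_parity z (Fm n)).
pose f j := ((F n)`_(2 * j + m))%:C * z ^+ (2 * j + m).
rewrite -/(f _); set S := size _.
(* The upper end becomes [maxn S T] so that the cut at [T] stays in range; the added coefficients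
   lie beyond the size of [F n] and vanish. *)
have -> : \sum_(0 <= j < S) f j = \sum_(0 <= j < T) f j + \sum_(T <= j < maxn S T) f j.
  rewrite -big_cat_nat ?leq_maxr// (big_cat_nat (leq0n S) (leq_maxl S T))/=.
  rewrite [X in _ = _ + X]big_nat_cond [X in _ = _ + X]big1 ?addr0// => j
    /andP[/andP[Sj _] _].
  rewrite /f nth_default ?realC0 ?mul0r//; apply: leq_trans Sj _.
  by rewrite mul2n -addnn -addnA leq_addr.
have [_ /(_ T)] := cK z zr; set g := power_sum c m z.
set gT := \sum_(0 <= _ < T) _ => gz.
have -> : \sum_(0 <= j < T) f j + \sum_(T <= j < maxn S T) f j - g =
    (\sum_(0 <= j < T) f j - gT) + \sum_(T <= j < maxn S T) f j + (gT - g).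
  by rewrite -!addrA; congr (_ + _); rewrite addrCA; congr (_ + _); rewrite addKr.
have -> : e%:C = (e / 3)%:C + (e / 3)%:C + (e / 3)%:C.
  by rewrite -!rmorphD; congr (_%:C); field.
apply: le_trans (ler_normD _ _) _; apply: lerD; last first.
  by rewrite distrC (le_trans gz)// lecR.
apply: le_trans (ler_normD _ _) _; apply: lerD; last first.
  apply: le_trans (norm_sum_half_le _ _ (fun j => power_term_le m rho1 zr (FnK' j))) _.
  by rewrite lecR.
rewrite -sumrB; apply: le_trans (ler_norm_sum _ _ _) _.
apply: (@le_trans _ _
  (\sum_(0 <= j < T) `|(F n)`_(2 * j + m) - c j| * rho ^+ (2 * j + m))%:C);
  last by rewrite lecR.
rewrite rmorph_sum /=; apply: ler_sum => j _.
rewrite -mulrBl -rmorphB normrM normC_real normrX rmorphM ler_wpM2l ?ler0c//.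
by rewrite rmorphXn lerXn2r// ?nnegrE ?ler0c// (le_trans _ rho1).
Unshelve. all: by end_near. Qed.

End coefficientwise.

(** * The Gamma function *)

Section gamma.
Variable R : realType.
Implicit Types (s t : R).
Local Notation mu := (@lebesgue_measure R).

Let gam s t : R := t `^ (s - 1) * expR (- t).
(** The Gamma integral with values in the extended reals, where the functional equation can be
    proved before finiteness is known. *)
Let E s : \bar R := (\int[mu]_(t in `]0%R, +oo[) (gam s t)%:E)%E.
(** An exhaustion of the half-line by compact intervals away from 0, on which the integrand is
    continuous and integration by parts is available. *)
Let D (n : nat) : set R := `[n.+1%:R^-1, n.+2%:R]%classic.

Let gam_ge0 s t : 0 <= gam s t.
Proof. by rewrite mulr_ge0 ?powR_ge0 ?expR_ge0. Qed.

Let E_ge0 s : (0 <= E s)%E.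
Proof. by apply: integral_ge0 => t _; rewrite lee_fin. Qed.

Let measurable_gam s : measurable_fun setT (gam s).
Proof.
apply: measurable_funM; first exact: measurable_powR.
by apply: measurableT_comp => //; exact: measurable_expR.
Qed.

Let measurable_gamE s (A : set R) : measurable_fun A (EFin \o gam s).
Proof. by apply/measurable_funTS/measurable_EFinP. Qed.

Let D_lt n : n.+1%:R^-1 < n.+2%:R :> R.
Proof.
apply: (@le_lt_trans _ _ 1); last by rewrite ltr1n.
by rewrite invf_le1 ?ltr0n// ler1n.
Qed.

Let bigcupD : \bigcup_n D n = `]0%R, +oo[%classic.
Proof.
apply/seteqP; split => t.
  move=> [n _]; rewrite /D /= !in_itv /= andbT => /andP[+ _].
  by apply: lt_le_trans; rewrite invr_gt0.
rewrite /= in_itv /= andbT => t0.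
pose n := (Num.truncn t + Num.truncn t^-1)%N; exists n => //.
rewrite /D /= in_itv /=; apply/andP; split.
  rewrite invf_ple ?posrE ?ltr0n//; apply/ltW/(lt_le_trans (truncnS_gt _)).
  by rewrite ler_nat ltnS leq_addl.
by apply/ltW/(lt_le_trans (truncnS_gt _)); rewrite ler_nat ltnW// !ltnS leq_addr.
Qed.

Let cvg_E s : (\int[mu]_(t in D n) (gam s t)%:E @[n --> \oo] --> E s)%E.
Proof.
rewrite /E -bigcupD; apply: ge0_nondecreasing_set_cvg_integral => //.
- apply/nondecreasing_seqP => n; rewrite subsetEset => t.
  rewrite /D /= !in_itv /= => /andP[h1 h2]; apply/andP; split.
    by apply: le_trans h1; rewrite lef_pV2 ?posrE ?ltr0n// ler_nat.
  by apply: le_trans h2 _; rewrite ler_nat.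
- by move=> i; exact: measurable_itv.
- by move=> i; exact: measurable_gamE.
- by move=> i t _; rewrite lee_fin.
Qed.

Let continuous_gam s (a b : R) : 0 < a -> {within `[a, b], continuous (gam s)}.
Proof.
move=> a0; apply: continuous_in_subspaceT => t.
rewrite inE /= in_itv /= => /andP[/(lt_le_trans a0) t0 _].
apply: cvgM.
  have : {for t, continuous (@powR R ^~ (s - 1))}.
    apply/differentiable_continuous/derivable1_diffP.
    exact: (@ex_derive _ _ _ _ _ _ _ (is_derive1_powR (s - 1) t0)).
  exact.
by apply: continuous_comp; [exact: opp_continuous|exact: continuous_expR].
Qed.

(** The function [F] is an antiderivative of [gam (s + 1) - s * gam s], so the fundamental theorem
    of calculus gives the boundary terms. *)
Let gam_parts s (a b : R) : 0 < a -> a < b ->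
  (\int[mu]_(t in `[a, b]) (gam (s + 1) t)%:E =
   (a `^ s * expR (- a) - b `^ s * expR (- b))%:E
   + s%:E * \int[mu]_(t in `[a, b]) (gam s t)%:E)%E.
Proof.
move=> a0 ab.
pose F t : R := - (t `^ s * expR (- t)).
pose f t : R := gam (s + 1) t - s * gam s t.
have dF t : 0 < t -> is_derive t 1 F (f t).
  move=> t0; have dp := is_derive1_powR s t0.
  rewrite /F; apply: is_derive_eq.
  rewrite /f /gam addrK /GRing.scale /=; ring.
have cF t : 0 < t -> {for t, continuous F}.
  move=> t0; apply/differentiable_continuous/derivable1_diffP.
  exact: (@ex_derive _ _ _ _ _ _ _ (dF t t0)).
have ci s' : mu.-integrable `[a, b] (EFin \o gam s').
  apply: continuous_compact_integrable; first exact: segment_compact.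
  exact: continuous_gam.
have b0 : 0 < b by exact: lt_trans ab.
have intE s' : exists x, (\int[mu]_(t in `[a, b]) (gam s' t)%:E)%E = x%:E.
  exists (fine (\int[mu]_(t in `[a, b]) (gam s' t)%:E)%E).
  by rewrite fineK// integrable_fin_num//; exact: ci.
have [x xE] := intE s; have [y yE] := intE (s + 1).
have := @continuous_FTC2 R f F a b ab.
have isg : mu.-integrable `[a, b] (EFin \o (fun t => s * gam s t)).
  by apply: (integrableZl _ s (ci s)).
have -> : (\int[mu]_(x in `[a, b]) (f x)%:E = y%:E - s%:E * x%:E)%E.
  rewrite /f integralB_EFin//.
  rewrite yE -xE -integralZl//; exact: (ci s).
rewrite xE yE => H.
have {H} : (y%:E - s%:E * x%:E = (F b)%:E - (F a)%:E)%E.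
  apply: H.
  - rewrite /f => t; apply: cvgB; first exact: continuous_gam.
    by apply: cvgMr; exact: continuous_gam.
  - split.
    + move=> t; rewrite in_itv /= => /andP[/(lt_trans a0) t0 _].
      exact: (@ex_derive _ _ _ _ _ _ _ (dF t t0)).
    + by apply/cvg_at_right_filter; exact: cF.
    + by apply/cvg_at_left_filter; exact: cF.
  - move=> t; rewrite in_itv /= => /andP[/(lt_trans a0) t0 _].
    by rewrite derive1E; have [_ ->] := dF t t0.
rewrite -!EFinM -!EFinB -EFinD /F => -[H]; congr _%:E; lra.
Qed.

Let powR_expRN_cvg0 s : n.+2%:R `^ s * expR (- n.+2%:R) @[n --> \oo] --> (0 : R).
Proof.
pose k := Num.truncn s.
have sk : s <= k.+1%:R by apply/ltW/truncnS_gt.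
apply: (@squeeze_cvgr _ _ _ _ (cst 0) (fun n => k.+2`!%:R * n.+1%:R^-1)).
- near=> n; rewrite mulr_ge0 ?powR_ge0 ?expR_ge0//=.
  set x : R := n.+2%:R; have x1 : 1 <= x by rewrite ler1n.
  have x0 : 0 < x by rewrite ltr0n.
  apply: (@le_trans _ _ (k.+2`!%:R * x^-1)); last first.
    by rewrite ler_wpM2l// lef_pV2 ?posrE ?ltr0n// ler_nat.
  rewrite expRN -ler_pdivlMr ?invr_gt0 ?expR_gt0// invrK.
  apply: (@le_trans _ _ (x ^+ k.+1)).
    by rewrite -powR_mulrn ?(ltW x0)//; exact: (ler_powR x1 sk).
  have := @expR_ge1Dxn R x k.+1 (ltW x0).
  rewrite -(ler_pM2l (x := k.+2`!%:R * x^-1)) ?mulr_gt0 ?invr_gt0 ?ltr0n ?fact_gt0//.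
  apply: le_trans; rewrite mulrDr mulr1.
  have -> : k.+2`!%:R / x * (x ^+ k.+2 / k.+2`!%:R) = x ^+ k.+1.
    rewrite [x ^+ k.+2]exprS; field.
    by rewrite gt_eqF//= pnatr_eq0 -lt0n fact_gt0.
  by rewrite lerDr mulr_ge0// invr_ge0 ltW.
- exact: cvg_cst.
- rewrite -[X in _ --> X](mulr0 k.+2`!%:R); apply: cvgMr.
  exact: cvg_harmonic.
Unshelve. all: by end_near. Qed.

Let powR_expRN_cvg0_at0 s : 0 < s ->
  (n.+1%:R^-1 `^ s) * expR (- n.+1%:R^-1) @[n --> \oo] --> (0 : R).
Proof.
move=> s0; rewrite -[X in _ --> X](mul0r (expR (- 0))); apply: cvgM.
  have h : (fun n => n.+1%:R^-1 : R) @ \oo --> (0:R)^'+.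
    move=> A [e /= e0 eA]; have /cvgrPdist_lt /(_ _ e0) := @cvg_harmonic R.
    by apply: filterS => n /= hn; apply: eA => //=; rewrite ?invr_gt0.
  exact: (cvg_comp _ _ h (powR_cvg0 s0)).
apply: (@cvg_comp _ _ _ (fun n : nat => - (n.+1%:R^-1 : R)) expR \oo (nbhs (- 0 : R))).
  by apply: cvgN; exact: cvg_harmonic.
exact: continuous_expR.
Qed.

Let E_rec s : 0 < s -> (E (s + 1) = s%:E * E s)%E.
Proof.
move=> s0.
have H : (\int[mu]_(t in D n) (gam (s + 1) t)%:E @[n --> \oo] --> 0 + s%:E * E s)%E.
  under eq_cvg do rewrite /D gam_parts//.
  apply: cvgeD => //.
    apply: cvg_EFin; first exact: nearW.
    rewrite -[X in _ --> X](subr0 0).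
    by apply: cvgB; [exact: powR_expRN_cvg0_at0|exact: powR_expRN_cvg0].
  by apply: cvgeZl => //; exact: cvg_E.
by rewrite -[RHS]add0e; exact: (cvg_unique _ (@cvg_E (s + 1)) H).
Qed.

Let E1_fin : (E 1 < +oo)%E.
Proof.
apply: (@le_lt_trans _ _ 1%E); last exact: ltry.
rewrite -(cvg_lim _ (@cvg_E 1))//; apply: lime_le; first exact: cvgP (@cvg_E 1).
near=> n.
(* At [s = 0] the remaining integral in [gam_parts] has coefficient 0, which leaves boundary terms
   at most 1. *)
rewrite -[in gam 1](add0r 1) /D gam_parts// mul0e adde0 lee_fin !powRr0 !mul1r.
rewrite (@le_trans _ _ (expR (- n.+1%:R^-1)))// ?lerBlDr ?lerDl ?expR_ge0//.
Unshelve. all: by end_near. Qed.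

Let Enat_fin n : (E n.+1%:R < +oo)%E.
Proof.
elim: n => [//|n IH]; rewrite -natr1 E_rec ?ltr0n//.
by rewrite lte_mul_pinfty ?lee_fin ?ler0n.
Qed.

Let E_fin_ge1 s : 1 <= s -> (E s < +oo)%E.
Proof.
move=> s1; pose n := Num.truncn s.
apply: (@le_lt_trans _ _ (E 1 + E n.+1%:R)%E); last first.
  exact: (lte_add_pinfty E1_fin (Enat_fin n)).
rewrite /E -ge0_integralD//; last 4 first.
- by move=> t _; rewrite lee_fin.
- exact: measurable_gamE.
- by move=> t _; rewrite lee_fin.
- exact: measurable_gamE.
apply: ge0_le_integral => //.
- by move=> t _; rewrite lee_fin.
- exact: measurable_gamE.
- by apply: emeasurable_funD; exact: measurable_gamE.
move=> t; rewrite /= in_itv /= andbT => t0.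
rewrite -EFinD lee_fin /gam -mulrDl ler_wpM2r ?expR_ge0//.
have [t1|t1] := orP (le_total t 1).
  rewrite ler_wpDr ?powR_ge0//; apply: ger_powR; last by lra.
  by rewrite t0.
rewrite ler_wpDl ?powR_ge0//; apply: ler_powR => //.
by rewrite lerD2r; apply/ltW/truncnS_gt.
Qed.

(* Below 1, finiteness is inherited from [s + 1], since the recurrence holds in
   the extended reals. *)
Let E_fin s : 0 < s -> (E s < +oo)%E.
Proof.
move=> s0; have := E_fin_ge1 (s := s + 1); rewrite lerDr (ltW s0) => /(_ isT).
rewrite (E_rec s0); case: (E s) => //; first by move=> x _; exact: ltry.
by rewrite gt0_muley ?lte_fin.
Qed.

Lemma Gamma_rec s : 0 < s -> Gamma (s + 1) = s * Gamma s.
Proof.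
move=> s0; rewrite /Gamma /Rintegral -/(gam _ _).
have := E_rec s0; rewrite /E /gam => ->.
by rewrite fineM// (ge0_fin_numE (E_ge0 s)) E_fin.
Qed.

(** For [s >= 1] the integrand is at least [expR (- 2)] on [[1, 2]]; smaller [s] follow from the
    functional equation. *)
Lemma Gamma_gt0 s : 0 < s -> 0 < Gamma s.
Proof.
have ge1 s' : 1 <= s' -> 0 < Gamma s'.
  move=> s1; have s0 : 0 < s' by exact: lt_le_trans s1.
  suff : ((expR (- 2))%:E <= E s')%E.
    move=> H; apply: (@lt_le_trans _ _ (expR (- 2))); first exact: expR_gt0.
    rewrite -lee_fin /Gamma /Rintegral fineK//.
    by rewrite (ge0_fin_numE (E_ge0 s')) E_fin.
  apply: (@le_trans _ _ (\int[mu]_(t in `[1%R, 2%R]) (expR (- 2))%:E)%E).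
    rewrite integral_cst//= lebesgue_measure_itv/= lte_fin ltr1n.
    by rewrite -EFinD -EFinM lee_fin -[leLHS]mulr1 ler_wpM2l ?expR_ge0//; lra.
  apply: (@le_trans _ _ (\int[mu]_(t in `[1%R, 2%R]) (gam s' t)%:E)%E).
    apply: ge0_le_integral => //.
    - exact: measurable_gamE.
    move=> t; rewrite /= in_itv /= => /andP[t1 t2]; rewrite lee_fin /gam.
    rewrite -[leLHS]mul1r ler_pM ?expR_ge0//; last by rewrite ler_expR lerN2.
    by rewrite -[leLHS](powRr0 t); apply: ler_powR => //; rewrite subr_ge0.
  apply: ge0_subset_integral => //.
  - exact: measurable_gamE.
  - by move=> t _; rewrite lee_fin.
  by move=> t; rewrite /= !in_itv /= andbT => /andP[t1 _]; lra.
move=> s0; have := ge1 (s + 1); rewrite lerDr (ltW s0) => /(_ isT).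
by rewrite Gamma_rec// pmulr_rgt0.
Qed.

Lemma Gamma_rising s n : 0 < s ->
  Gamma (n%:R + s) = (\prod_(l < n) (s + l%:R)) * Gamma s.
Proof.
move=> s0; elim: n => [|n IH]; first by rewrite big_ord0 add0r mul1r.
have ns0 : 0 < n%:R + s by rewrite ltr_wpDl.
rewrite big_ord_recr /= mulrAC -IH -natr1 addrAC (Gamma_rec ns0).
by rewrite mulrC [s + _]addrC.
Qed.

End gamma.

(** * Power asymptotics of sequences *)

Section power_asymptotics.
Variable R : realType.
Implicit Types (f g : nat -> R) (c d s t : R).

(** Unlike [asymp_equiv], this form also makes sense for [c = 0], where it says that [f] is
    negligible against the power. *)
Definition power_asymp f c s := (fun n => f n / n%:R `^ s) @ \oo --> c.

Lemma asymp_equiv_power f c s : 0 < c ->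
  asymp_equiv f (fun n => c * n%:R `^ s) -> power_asymp f c s.
Proof.
move=> c0 fc; rewrite /power_asymp -[X in _ --> X](mul1r c).
rewrite (_ : (fun n => f n / _) = (fun n => f n / (c * n%:R `^ s) * c)).
  by apply: cvgM; [exact: fc|exact: cvg_cst].
apply/funext => n; rewrite invfM -!mulrA; congr (_ * _).
by rewrite mulrCA mulVf ?gt_eqF// mulr1.
Qed.

Lemma power_asympM f g c d s t : power_asymp f c s -> power_asymp g d t ->
  power_asymp (fun n => f n * g n) (c * d) (s + t).
Proof.
move=> fc gd; apply: (near_eq_cvgn _ (cvgM fc gd)).
near=> n; rewrite /= powRD; last first.
  by apply/implyP => _; rewrite pnatr_eq0 -lt0n; near: n; exact: nbhs_infty_gt.
by rewrite invfM mulrACA.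
Unshelve. all: by end_near. Qed.

Lemma power_asympX f c s k : power_asymp f c s ->
  power_asymp (fun n => f n ^+ k) (c ^+ k) (s * k%:R).
Proof.
move=> fc; elim: k => [|k IH].
  rewrite /power_asymp; under eq_fun do rewrite expr0 mulr0 powRr0 divr1.
  exact: cvg_cst.
rewrite -natr1 mulrDr mulr1 exprSr; under eq_fun do rewrite exprSr.
exact: power_asympM.
Qed.

Lemma power_asympV f c s : c != 0 -> power_asymp f c s ->
  power_asymp (fun n => (f n)^-1) c^-1 (- s).
Proof.
move=> c0 fc; rewrite /power_asymp.
by under eq_fun do rewrite powRN -invfM; exact: cvgV.
Qed.

Lemma power_asymp_nat : power_asymp (fun n => n%:R) 1 1.
Proof.
apply: (near_eq_cvgn _ (cvg_cst (1 : R))); near=> n.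
rewrite powRr1// divff// pnatr_eq0 -lt0n.
by near: n; exact: nbhs_infty_gt.
Unshelve. all: by end_near. Qed.

Lemma power_asymp0 f c : power_asymp f c 0 <-> f @ \oo --> c.
Proof. by rewrite /power_asymp; under eq_fun do rewrite powRr0 divr1. Qed.

Lemma natr_powR_cvgy s : 0 < s -> forall M, \forall n \near \oo, M <= n%:R `^ s :> R.
Proof.
move=> s0 M; have [M0|M0] := leP M 0.
  by apply: nearW => n; exact: le_trans (powR_ge0 _ _).
have : \forall n \near \oo, (M `^ s^-1 <= n%:R :> R) by exact: nbhs_infty_ger.
apply: filterS => n Mn.
have -> : M = (M `^ s^-1) `^ s by rewrite -powRrM mulVf ?lt0r_neq0// powRr1// ltW.
by apply: ge0_ler_powR; rewrite ?nnegrE ?powR_ge0 ?(ltW s0) ?ler0n ?Mn.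
Qed.

Lemma power_asymp_neg f c s : s < 0 -> power_asymp f c s -> f @ \oo --> (0 : R).
Proof.
move=> s0 fc.
have h : (fun n => n%:R `^ s : R) @ \oo --> (0 : R).
  apply/cvgrPdist_le => e e0; have := natr_powR_cvgy (s := - s).
  rewrite oppr_gt0 => /(_ s0 e^-1); apply: filterS => n.
  rewrite powRN sub0r normrN ger0_norm ?powR_ge0// => en.
  by rewrite -[leLHS]invrK invf_ple ?posrE// (lt_le_trans _ en)// invr_gt0.
rewrite -[X in _ --> X](mulr0 c); apply: (near_eq_cvgn _ (cvgM fc h)).
near=> n; rewrite /= divfK// gt_eqF// powR_gt0// ltr0n.
by near: n; exact: nbhs_infty_gt.
Unshelve. all: by end_near. Qed.

(** Beyond some [N] the increments of [w = x - c * y] are at most [e / 2] times those of [y].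
    Telescoping bounds [w], and the constant [w N] is negligible because [y] tends to infinity. *)
Lemma stolz_cesaro (x y : nat -> R) c :
  (forall n, y n < y n.+1) -> (forall n, 0 <= y n) ->
  (forall M, \forall n \near \oo, M <= y n) ->
  (fun n => (x n.+1 - x n) / (y n.+1 - y n)) @ \oo --> c ->
  (fun n => x n / y n) @ \oo --> c.
Proof.
move=> yS y0 yy xc; apply/cvgrPdist_le => e e0.
have e20 : 0 < e / 2 by rewrite divr_gt0.
move/cvgrPdist_le : xc => /(_ _ e20) [N _ NP].
pose w n := x n - c * y n.
have step n : (N <= n)%N -> `|w n| <= `|w N| + e / 2 * (y n - y N).
  elim: n => [|n IH]; first by rewrite leqn0 => /eqP ->; rewrite subrr mulr0 addr0.
  rewrite leq_eqVlt => /predU1P[->|]; first by rewrite subrr mulr0 addr0.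
  rewrite ltnS => Nn; have dy0 : 0 < y n.+1 - y n by rewrite subr_gt0.
  have {}IH := IH Nn; have := NP n Nn.
  have -> : w n.+1 = w n - (c - (x n.+1 - x n) / (y n.+1 - y n)) * (y n.+1 - y n).
    by rewrite mulrBl divfK ?gt_eqF// /w; ring.
  move=> H; apply: le_trans (ler_normB _ _) _; rewrite normrM (gtr0_norm dy0).
  have := ler_wpM2r (ltW dy0) H; move: IH; lra.
near=> n; have Nn : (N <= n)%N by near: n; exact: nbhs_infty_ge.
have yn : `|w N| * (2 / e) <= y n by near: n; exact: yy.
have yn1 : 1 <= y n by near: n; exact: yy.
have yn0 : 0 < y n by exact: lt_le_trans yn1.
have -> : c - x n / y n = - (w n / y n).
  by rewrite /w; field; rewrite gt_eqF.
rewrite normrN normrM normfV (gtr0_norm yn0) ler_pdivrMr//.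
apply: le_trans (step n Nn) _.
have : `|w N| <= e / 2 * y n.
  have -> : `|w N| = e / 2 * (`|w N| * (2 / e)) by field; rewrite gt_eqF.
  by rewrite ler_wpM2l// ltW.
have := mulr_ge0 (ltW e20) (y0 N); lra.
Unshelve. all: by end_near. Qed.

(** The quotient is the difference quotient of the power function at 1 with step [- n.+1%:R^-1],
    because [n / (n + 1) = 1 - 1 / (n + 1)]. *)
Lemma powR_increment_cvg s :
  (fun n => (n.+1%:R `^ s - n%:R `^ s) / n.+1%:R `^ (s - 1)) @ \oo --> (s : R).
Proof.
have [d1 d2] := is_derive1_powR s (ltr01 : 0 < (1 : R)).
rewrite powR1 mulr1 in d2.
have hn : (fun n : nat => - (n.+1%:R^-1 : R)) @ \oo --> (0 : R)^'.
  move=> E [e /= e0 eE]; have /cvgrPdist_lt /(_ _ e0) := @cvg_harmonic R.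
  apply: filterS => n /= hn; apply: eE => /=; last by rewrite oppr_eq0 invr_eq0 pnatr_eq0.
  by rewrite opprK add0r; rewrite sub0r normrN in hn.
have := cvg_comp _ _ hn d1; rewrite -/(derive _ _ _) d2.
apply: near_eq_cvgn; near=> n.
have n0 : (0 < n)%N by near: n; exact: nbhs_infty_gt.
have n10 : 0 < n.+1%:R :> R by rewrite ltr0n.
rewrite /= /GRing.scale /= powR1 mulr1.
have -> : - n.+1%:R^-1 + 1 = n%:R * n.+1%:R^-1 :> R.
  by rewrite -natr1; field; rewrite natr1 gt_eqF.
rewrite powRM ?invr_ge0// powRB ?(gt_eqF n10) ?implybT// powRr1 ?ltW//.
have -> : (n.+1%:R^-1) `^ s = (n.+1%:R `^ s)^-1 :> R.
  rewrite -powRN -(powR_inv1 (ltW n10)) -powRrM mulN1r//.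
have : n.+1%:R `^ s != 0 :> R by rewrite gt_eqF ?powR_gt0.
by move=> ?; field; rewrite gt_eqF.
Unshelve. all: by end_near. Qed.

Lemma power_asymp_sum f c s : 0 < s -> power_asymp f c (s - 1) ->
  power_asymp (fun n => \sum_(k < n.+1) f k) (c / s) s.
Proof.
move=> s0 fc; apply: stolz_cesaro.
- by move=> n; apply: gt0_ltr_powR; rewrite ?nnegrE ?ltr_nat.
- by move=> n; exact: powR_ge0.
- exact: natr_powR_cvgy.
have f1 : (fun n => f n.+1 / n.+1%:R `^ (s - 1)) @ \oo --> c.
  by move: fc; rewrite /power_asymp -cvg_shiftS.
have H : (fun n => f n.+1 / n.+1%:R `^ (s - 1) *
    ((n.+1%:R `^ s - n%:R `^ s) / n.+1%:R `^ (s - 1))^-1) @ \oo --> c / s.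
  apply: cvgM f1 _; apply: cvgV; first exact: lt0r_neq0.
  exact: powR_increment_cvg.
apply: near_eq_cvgn H; apply: nearW => n /=.
rewrite big_ord_recr /= addrAC subrr add0r.
by rewrite invfM invrK mulrACA mulVf ?mulr1// gt_eqF// powR_gt0.
Qed.

Lemma power_asymp_ratio f g c d s : d != 0 -> power_asymp f c s ->
  power_asymp g d s -> (fun n => f n / g n) @ \oo --> c / d.
Proof.
move=> d0 fc gd; apply/power_asymp0; rewrite -(subrr s).
by apply: power_asympM => //; exact: power_asympV.
Qed.

End power_asymptotics.

(** * Cauchy matrices *)

Section linear_systems.
Variable R : realType.

Lemma cvgn_prod I (r : seq I) (f : I -> nat -> R) (l : I -> R) :
  (forall i, f i @ \oo --> l i) ->
  (fun n => \prod_(i <- r) f i n) @ \oo --> \prod_(i <- r) l i.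
Proof.
move=> fl; elim: r => [|i r IH].
  rewrite big_nil (_ : (fun _ => _) = cst 1); first exact: cvg_cst.
  by apply/funext => n; rewrite big_nil.
rewrite big_cons (_ : (fun _ => _) = (fun n => f i n * \prod_(j <- r) f j n)).
  by apply: cvgM.
by apply/funext => n; rewrite big_cons.
Qed.

Lemma cvgn_det n (A : nat -> 'M[R]_n) (K : 'M[R]_n) :
  (forall i j, (fun N => A N i j) @ \oo --> K i j) ->
  (fun N => \det (A N)) @ \oo --> \det K.
Proof.
move=> AK; apply: cvgn_sum => s _; apply: cvgMr.
by apply: cvgn_prod => i; exact: AK.
Qed.

Lemma cvgn_linear_system n (A : nat -> 'M[R]_n) (K : 'M[R]_n)
    (x y : nat -> 'rV[R]_n) (z : 'rV[R]_n) :
  K \in unitmx ->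
  (forall i j, (fun N => A N i j) @ \oo --> K i j) ->
  (forall j, (fun N => y N 0 j) @ \oo --> z 0 j) ->
  (\forall N \near \oo, x N *m A N = y N) ->
  forall j, (fun N => x N 0 j) @ \oo --> (z *m invmx K) 0 j.
Proof.
(* By Cramer's rule the solution is a continuous function of the data. *)
move=> Ku AK yz xy j.
have detK : \det K != 0 by move: Ku; rewrite unitmxE unitfE.
have dA : \forall N \near \oo, \det (A N) != 0.
  have /cvgrPdist_lt/(_ `|\det K|) := cvgn_det AK.
  rewrite normr_gt0 => /(_ detK); apply: filterS => N.
  by apply: contraTneq => ->; rewrite subr0 ltxx.
have -> : (z *m invmx K) 0 j = (\det K)^-1 * \sum_i z 0 i * (\adj K) i j.
  rewrite /invmx Ku mxE mulr_sumr; apply: eq_bigr => i _.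
  by rewrite mxE mulrCA.
apply: (@near_eq_cvgn _ (fun N => (\det (A N))^-1 * \sum_i y N 0 i * (\adj (A N)) i j)).
  near=> N.
  have Au : A N \in unitmx by rewrite unitmxE unitfE; near: N.
  have -> : x N = y N *m invmx (A N).
    by rewrite -[LHS](mulmxK Au); congr (_ *m _); near: N.
  rewrite /invmx Au mxE mulr_sumr; apply: eq_bigr => i _.
  by rewrite [in RHS]mxE mulrCA.
apply: cvgM; first by apply: cvgV => //; exact: cvgn_det.
apply: cvgn_sum => i _; apply: cvgM; first exact: yz.
rewrite mxE /cofactor.
rewrite (_ : (fun N => _) = (fun N => (-1) ^+ (j + i) * \det (row' j (col' i (A N))))).
  apply: cvgMr; apply: cvgn_det => k l.
  rewrite !mxE (_ : (fun N => _) = (fun N => A N (lift j k) (lift i l))) //.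
  by apply/funext => N; rewrite !mxE.
by apply/funext => N; rewrite mxE.
Unshelve. all: by end_near. Qed.

End linear_systems.

(** * Partial fractions and Cauchy systems *)

Section cauchy_matrix.
Variables (R : realType) (r : nat) (t : R).
Hypothesis t0 : 0 < t.
Implicit Types x : 'I_r.+1 -> R.

(** The numerator, over the common denominator [den], of the partial fractions with poles
    [- (t + i)] and residues [x i]. *)
Let num x : {poly R} :=
  \sum_i x i *: \prod_(l < r.+1 | l != i) ('X + (t + l%:R)%:P).

Let size_prodXadd (P : pred 'I_r.+1) :
  size (\prod_(l < r.+1 | P l) ('X + (t + l%:R)%:P)) = #|P|.+1.
Proof.
rewrite size_prod => [|i _]; last by rewrite -size_poly_eq0 size_XaddC.
rewrite (eq_bigr (fun=> 2%N)) => [|i _]; last by rewrite size_XaddC.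
by rewrite sum_nat_const muln2 -addnn subSn ?addnK// leq_addl.
Qed.

Let size_num x : (size (num x) <= r.+1)%N.
Proof.
apply: leq_trans (size_sum _ _ _) _; apply/bigmax_leqP => i _.
apply: leq_trans (size_scale_leq _ _) _; rewrite size_prodXadd.
by rewrite cardC1 card_ord.
Qed.

Let den : {poly R} := \prod_(l < r.+1) ('X + (t + l%:R)%:P).

Let den_neq0 (s : R) : 0 <= s -> den.[s] != 0.
Proof.
move=> s0; rewrite horner_prod; apply/prodf_neq0 => l _.
by rewrite hornerD hornerX hornerC lt0r_neq0// ltr_wpDl// ltr_pwDl ?ler0n.
Qed.

Let num_div x (s : R) : 0 <= s ->
  (num x).[s] / den.[s] = \sum_i x i / (t + i%:R + s).
Proof.
move=> s0; rewrite horner_sum mulr_suml; apply: eq_bigr => i _.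
rewrite hornerZ /den [X in _ / X.[s]](bigD1 i)//= hornerM hornerD hornerX hornerC.
rewrite -mulrA; congr (_ * _).
set q := (\prod_(_ < _ | _) _).[s].
have q0 : q != 0.
  rewrite /q horner_prod; apply/prodf_neq0 => l _.
  by rewrite hornerD hornerX hornerC lt0r_neq0// ltr_wpDl// ltr_pwDl ?ler0n.
by rewrite invfM mulrCA mulfV// mulr1 addrC.
Qed.

(** The numerator has degree at most [r] and vanishes at [0, ..., r], so it is zero; its value at
    the pole [- (t + i)] is a nonzero multiple of [x i]. *)
Lemma cauchy_kernel x :
  (forall j : 'I_r.+1, \sum_i x i / (t + i%:R + j%:R) = 0) -> forall i, x i = 0.
Proof.
move=> xj i.
have num0 : num x = 0.
  apply: (@roots_geq_poly_eq0 _ _ [seq k%:R | k <- iota 0 r.+1]).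
  - apply/allP => s /mapP[k]; rewrite mem_iota /= add0n => kr ->.
    have := xj (Ordinal kr); rewrite -num_div// => /eqP.
    by rewrite mulf_eq0 invr_eq0 (negbTE (den_neq0 (ler0n _ k))) orbF.
  - by rewrite map_inj_uniq ?iota_uniq//; exact: mulrIn (oner_neq0 R).
  - by rewrite size_map size_iota; exact: size_num.
have : (num x).[- (t + i%:R)] = 0 by rewrite num0 horner0.
rewrite horner_sum (bigD1 i)//= [X in _ + X]big1 ?addr0 => [|l li].
  rewrite hornerZ => /eqP; rewrite mulf_eq0 => /orP[/eqP//|].
  rewrite horner_prod => /prodf_eq0[l li]; rewrite hornerD hornerX hornerC addrC subr_eq0.
  by rewrite (inj_eq (addrI t)) eqr_nat => /eqP/val_inj li'; rewrite li' eqxx in li.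
rewrite hornerZ horner_prod (bigD1 i) 1?eq_sym//= hornerD hornerX hornerC.
by rewrite addNr mul0r mulr0.
Qed.

Lemma cauchy_unitmx (u v : 'I_r.+1 -> R) (K : 'M[R]_r.+1) :
  (forall i, u i != 0) -> (forall j, v j != 0) ->
  (forall i j, K i j = u i * v j / (t + i%:R + j%:R)) -> K \in unitmx.
Proof.
move=> u0 v0 KE; rewrite -row_free_unit; apply: inj_row_free => x xK.
apply/rowP => i; rewrite mxE.
suff /eqP : x 0 i * u i = 0 by rewrite mulf_eq0 (negbTE (u0 i)) orbF => /eqP.
apply: (cauchy_kernel (x := fun i => x 0 i * u i)).
move=> j; have /eqP := congr1 (fun A : 'rV[R]_r.+1 => A 0 j) xK; rewrite !mxE.
rewrite (eq_bigr (fun i => v j * (x 0 i * u i / (t + i%:R + j%:R)))) => [|k _].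
  by rewrite -mulr_sumr mulf_eq0 (negbTE (v0 j)) /= => /eqP.
by rewrite KE; ring.
Qed.

(** The polynomial [den - num x] is monic of degree [r + 1] and vanishes at [0, ..., r], so it is
    the product of the ['X - l]. *)
Lemma cauchy_residual x (s : R) : 0 <= s ->
  (forall j : 'I_r.+1, \sum_i x i / (t + i%:R + j%:R) = 1) ->
  1 - \sum_i x i / (t + i%:R + s)
    = \prod_(l < r.+1) ((s - l%:R) / (t + l%:R + s)).
Proof.
move=> s0 xj; rewrite -num_div// -[X in X - _](mulfV (den_neq0 s0)) -mulrBl -hornerN
  -hornerD.
have sden : size den = r.+2 by rewrite size_prodXadd card_ord.
have mden : den \is monic.
  by apply: monic_prod => l _; rewrite monicXaddC.
have szN : (size (- num x) < size den)%N by rewrite sden size_polyN ltnS size_num.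
pose rs : seq R := [seq k%:R | k <- iota 0 r.+1].
have rootsN : all (root (den - num x)) rs.
  apply/allP => z /mapP[k]; rewrite mem_iota /= add0n => kr ->.
  rewrite /root hornerD hornerN subr_eq0; apply/eqP.
  have := xj (Ordinal kr); rewrite -num_div//= => /(congr1 (fun z => z * den.[k%:R])).
  by rewrite mul1r divfK ?den_neq0.
have urs : uniq_roots rs.
  rewrite uniq_rootsE map_inj_uniq ?iota_uniq//; exact: mulrIn (oner_neq0 R).
rewrite (@all_roots_prod_XsubC _ (den - num x) rs)//; last first.
  by rewrite size_polyDl// sden size_map size_iota.
rewrite lead_coefDl// (monicP mden) scale1r big_map /index_iota.
rewrite -[r.+1]subn0 -/(index_iota 0 r.+1) big_mkord subn0.
rewrite !horner_prod -prodf_div; apply: eq_bigr => l _.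
by rewrite !hornerD !hornerX hornerN !hornerC; congr (_ / _); rewrite addrC.
Qed.

End cauchy_matrix.

(** * Asymptotics of the perturbed coefficients *)

(** If [x] is the coefficient of degree [2 * j + e] of a polynomial [f], this is the same
    coefficient of [(-1)^N al_N f(z / b_N)]. *)
Definition rescale (R : realType) (al b_ : nat -> R) (e N j : nat) (x : R) : R :=
  (-1) ^+ N * al N * x / b_ N ^+ (2 * j + e).

Section perturbed_kernel.
Variables (R : realType) (r e : nat) (al b_ : nat -> R) (A B a b th : R).
Hypotheses (al0 : forall n, 0 < al n) (b_0 : forall n, 0 < b_ n).
Hypotheses (A0 : 0 < A) (B0 : 0 < B) (b0 : 0 < b) (th0 : 0 < th).
Hypothesis hal : power_asymp (fun n => (al n)^-1) A a.
Hypothesis hb_ : power_asymp b_ B b.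
Hypothesis hab : 2 * a + 1 + 2 * b * e%:R = 2 * b * th.

(** The order of magnitude of a product of two unscaled coefficients whose degrees add up to [d]. *)
Let W d (k : nat) : R := (al k)^-1 ^+ 2 * b_ k ^+ d.

Let W0 d k : 0 < W d k.
Proof. by rewrite mulr_gt0 ?exprn_gt0 ?invr_gt0. Qed.

Let WD d d' k : W (d + d') k = W d k * b_ k ^+ d'.
Proof. by rewrite /W exprD mulrA. Qed.

(** The exponent of growth of the kernel sums; [hab] makes the summands [W (2 * (l + e))] grow with
    exponent [expo l - 1]. *)
Let expo (l : nat) : R := 2 * b * (th + l%:R).

Let expo_gt0 l : 0 < expo l.
Proof. by rewrite !mulr_gt0// ltr_pwDl ?ler0n. Qed.

Let W_asymp l : power_asymp (W (2 * (l + e))) (A ^+ 2 * B ^+ (2 * (l + e))) (expo l - 1).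
Proof.
have -> : expo l - 1 = a * 2%:R + b * (2 * (l + e))%:R.
  by rewrite /expo mulrDr -hab natrM natrD; ring.
by apply: power_asympM; exact: power_asympX.
Qed.

Let NW_asymp l : power_asymp (fun N => W (2 * (l + e)) N * N%:R)
  (A ^+ 2 * B ^+ (2 * (l + e))) (expo l).
Proof.
rewrite -[expo l](subrK 1) -[X in power_asymp _ X]mulr1.
by apply: power_asympM => //; exact: power_asymp_nat.
Qed.

Let mean_cvg l (g : nat -> R) (y : R) : g @ \oo --> y ->
  (fun N => (\sum_(k < N.+1) W (2 * (l + e)) k * g k) / (W (2 * (l + e)) N * N%:R))
    @ \oo --> y / expo l.
Proof.
move=> gy; set c := A ^+ 2 * B ^+ (2 * (l + e)).
have c0 : c != 0 by rewrite mulf_neq0// expf_neq0// lt0r_neq0.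
have -> : y / expo l = c * y / expo l / c by field; rewrite c0 lt0r_neq0.
apply: (power_asymp_ratio c0 _ (@NW_asymp l)).
apply: (power_asymp_sum (f := fun k => W (2 * (l + e)) k * g k) (@expo_gt0 l)).
rewrite -[X in power_asymp _ _ X]addr0.
by apply: power_asympM; [exact: W_asymp|apply/power_asymp0].
Qed.

(** The sequence [b_] need not be monotone; this substitute compares [b_ k] with [b_ N] for all
    [k <= N] at once. *)
Let b_le : exists C : R, 1 <= C /\
  \forall N \near \oo, forall k, (k <= N)%N -> b_ k <= C * b_ N.
Proof.
have B20 : 0 < B / 2 by rewrite divr_gt0.
have /cvgrPdist_le/(_ _ B20)[N1 _ N1P] := hb_.
pose D := \sum_(k < N1) b_ k.
have D0 : 0 <= D by rewrite sumr_ge0// => k _; rewrite ltW.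
have bnd k : (N1 < k)%N ->
    B / 2 * k%:R `^ b <= b_ k /\ b_ k <= 2 * B * k%:R `^ b.
  move=> /[dup] N1k /ltnW /N1P /=.
  have k0 : 0 < k%:R `^ b by rewrite powR_gt0// ltr0n (leq_ltn_trans _ N1k).
  have -> : b_ k = b_ k / k%:R `^ b * k%:R `^ b by rewrite divfK ?gt_eqF.
  rewrite mulfK ?gt_eqF//; set q := _ / _; rewrite ler_norml => /andP[h1 h2].
  by rewrite !ler_pM2r//; split; lra.
(* Beyond [N1], [b_ k] lies between [B / 2] and [2 * B] times the power of [k], whence the ratio 4;
   the second term covers [k <= N1], using [b_ N >= B / 2]. *)
exists (4 + (D + b_ N1) * (2 / B)); split.
  have : 0 <= (D + b_ N1) * (2 / B).
    by rewrite mulr_ge0 ?addr_ge0 ?divr_ge0// ltW.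
  lra.
near=> N => k kN.
have N1N : (N1 < N)%N by near: N; exact: nbhs_infty_gt.
have N1le : 1 <= N%:R `^ b.
  rewrite -[leLHS](powRr0 N%:R); apply: ler_powR; last exact: ltW.
  by rewrite ler1n (leq_ltn_trans _ N1N).
have [bN1 _] := bnd N N1N.
rewrite mulrDl; have [N1k|kN1] := ltnP N1 k.
  have [_ bk2] := bnd k N1k.
  apply: (@le_trans _ _ (4 * b_ N)).
    apply: le_trans bk2 _.
    have : k%:R `^ b <= N%:R `^ b :> R.
      by apply: ge0_ler_powR; rewrite ?nnegrE ?ler0n ?ler_nat ?(ltW b0).
    move=> kb; have := ler_wpM2l (ltW B0) kb; lra.
  by rewrite lerDl !mulr_ge0// ?invr_ge0 ?addr_ge0// ltW.
apply: (@le_trans _ _ (D + b_ N1)).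
  move: kN1; rewrite leq_eqVlt => /predU1P[->|kN1]; first by rewrite lerDr.
  rewrite -[leLHS]addr0; apply: lerD; last exact: ltW.
  rewrite /D (bigD1 (Ordinal kN1))//= lerDl sumr_ge0// => i _; exact: ltW.
apply: (@le_trans _ _ ((D + b_ N1) * (2 / B) * b_ N)).
  rewrite -mulrA ler_peMr ?addr_ge0 ?(ltW (b_0 _))//.
  have h : B / 2 <= b_ N by apply: le_trans bN1; rewrite ler_peMr// ltW.
  have B2i : 0 <= 2 / B by rewrite divr_ge0// ltW.
  have := ler_wpM2l B2i h; apply: le_trans.
  by rewrite (_ : 2 / B * (B / 2) = 1)//; field; rewrite gt_eqF.
by rewrite lerDr mulr_ge0// ltW.
Unshelve. all: by end_near. Qed.

(** [P N j] stands for the coefficient of degree [2 * j + e] of [p_(2N+e)], and [be j] for its limit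
    after rescaling; no polynomial occurs in this section. *)
Variables (P : nat -> nat -> R) (be : nat -> R).
Let scale N j (x : R) := rescale al b_ e N j x.
Let pin N j := scale N j (P N j).
Hypothesis pin_cvg : forall j, (fun N => rescale al b_ e N j (P N j)) @ \oo --> be j.
Hypothesis pin_bnd : forall rho, 1 <= rho ->
  exists K, forall N j, `|rescale al b_ e N j (P N j)| * rho ^+ j <= K.
Hypothesis be0 : forall j, be j != 0.

Let bN0 N k : b_ N ^+ k != 0. Proof. by rewrite expf_neq0// gt_eqF. Qed.
Let alN0 N : al N != 0. Proof. by rewrite gt_eqF. Qed.
Let sgn2 N : (-1) ^+ N * (-1) ^+ N = 1 :> R.
Proof. by rewrite -expr2 sqrr_sign. Qed.

Let PE k j : P k j = (-1) ^+ k * pin k j * b_ k ^+ (2 * j + e) / al k.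
Proof.
rewrite /pin /scale /rescale -[LHS]mul1r -[X in X * _ = _](sgn2 k); field.
by rewrite alN0 bN0.
Qed.

Let ka N i j : R :=
  (\sum_(k < N.+1) P k i * P k j) / (W (2 * (i + j + e)) N * N%:R).

Let PP k i j : P k i * P k j = W (2 * (i + j + e)) k * (pin k i * pin k j).
Proof.
rewrite !PE /W.
have -> : (2 * (i + j + e) = (2 * i + e) + (2 * j + e))%N by lia.
rewrite [b_ k ^+ (_ + e + _)]exprD -[RHS]mul1r -[X in _ = X * _](sgn2 k); ring.
Qed.

Let ka_cvg i j : (fun N => ka N i j) @ \oo --> be i * be j / expo (i + j).
Proof.
have pij : (fun k => pin k i * pin k j) @ \oo --> be i * be j.
  by apply: cvgM; exact: pin_cvg.
apply: (near_eq_cvgn _ (mean_cvg (l := i + j) pij)); apply: nearW => N; rewrite /ka.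
by under [in RHS]eq_bigr do rewrite PP.
Qed.

Let ka_bnd i rho : 1 <= rho -> exists K, \forall N \near \oo,
  forall j, `|ka N i j| * rho ^+ j <= K.
Proof.
move=> rho1; have [C [C1 Cb]] := b_le.
(* The enlarged radius absorbs the factor [(C ^+ 2) ^+ j] lost when [b_ k ^+ (2 * j)] is replaced by
   [b_ N ^+ (2 * j)]. *)
have [|K piK] := pin_bnd (rho := C ^+ 2 * rho).
  by rewrite mulr_ege1// exprn_ege1.
have {}piK k j : `|pin k j| * (C ^+ 2 * rho) ^+ j <= K by exact: piK.
have K0 : 0 <= K by apply: le_trans (piK 0 0); rewrite expr0 mulr1.
have pi : (fun k => `|pin k i|) @ \oo --> `|be i| by apply: cvg_norm; exact: pin_cvg.
have /cvgrPdist_le/(_ _ ltr01) mN := mean_cvg (l := i) pi.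
exists ((`|be i| / expo i + 1) * K); near=> N => j.
have N0 : (0 < N)%N by near: N; exact: nbhs_infty_gt.
have N0R : 0 < N%:R :> R by rewrite ltr0n.
have CN : forall k, (k <= N)%N -> b_ k <= C * b_ N by near: N.
have mNN : `|(`|be i| / expo i) - (\sum_(k < N.+1) W (2 * (i + e)) k * `|pin k i|)
    / (W (2 * (i + e)) N * N%:R)| <= 1 by near: N; exact: mN.
set mn := (X in _ - X) in mNN.
have mn_le : mn <= `|be i| / expo i + 1.
  by move: mNN; rewrite ler_norml => /andP[h _]; move: h; lra.
apply: (@le_trans _ _ (mn * K)); last by rewrite ler_wpM2r.
have WN0 : 0 < W (2 * (i + j + e)) N * N%:R by rewrite mulr_gt0.
have Eij : (2 * (i + j + e) = 2 * (i + e) + 2 * j)%N by rewrite -mulnDr addnAC.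
rewrite /ka normrM normfV (gtr0_norm WN0) mulrAC ler_pdivrMr//.
have -> : mn * K * (W (2 * (i + j + e)) N * N%:R)
    = (\sum_(k < N.+1) W (2 * (i + e)) k * `|pin k i|) * K * b_ N ^+ (2 * j).
  rewrite Eij WD /mn; field.
  by rewrite (gt_eqF N0R) gt_eqF.
rewrite -mulrA [K * _]mulrC mulr_suml.
apply: le_trans (ler_wpM2r _ (ler_norm_sum _ _ _)) _.
  by rewrite exprn_ge0// (le_trans _ rho1).
rewrite mulr_suml; apply: ler_sum => k _.
have kN : (k <= N)%N by rewrite -ltnS.
rewrite PP normrM (gtr0_norm (W0 _ _)) Eij WD normrM.
have bk : b_ k ^+ (2 * j) <= (C ^+ 2) ^+ j * b_ N ^+ (2 * j).
  rewrite !exprM -exprMn -[X in _ <= (X) ^+ _]exprMn lerXn2r ?nnegrE ?sqr_ge0//.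
  by rewrite lerXn2r ?nnegrE ?mulr_ge0 ?(ltW (b_0 _)) ?CN// (le_trans _ C1).
have -> : W (2 * (i + e)) k * b_ k ^+ (2 * j) * (`|pin k i| * `|pin k j|) * rho ^+ j
  = W (2 * (i + e)) k * `|pin k i| * (b_ k ^+ (2 * j) * (`|pin k j| * rho ^+ j)) by ring.
apply: ler_wpM2l; first by apply: mulr_ge0 => //; exact/ltW/W0.
apply: (@le_trans _ _ ((C ^+ 2) ^+ j * b_ N ^+ (2 * j) * (`|pin k j| * rho ^+ j))).
  by rewrite ler_wpM2r// mulr_ge0// exprn_ge0// (le_trans _ rho1).
have -> : (C ^+ 2) ^+ j * b_ N ^+ (2 * j) * (`|pin k j| * rho ^+ j)
  = b_ N ^+ (2 * j) * (`|pin k j| * (C ^+ 2 * rho) ^+ j).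
  by rewrite [(C ^+ 2 * rho) ^+ j]exprMn; ring.
by rewrite ler_wpM2l// exprn_ge0// ltW.
Unshelve. all: by end_near. Qed.

(** [T N j] stands for [c N] times the coefficient of degree [2 * j + e] of [q_(2N+e)], and [m] for
    the weights of that parity. *)
Variables (T : nat -> nat -> R) (c : nat -> R) (m : 'I_r.+1 -> R).
Hypothesis m0 : forall i, 0 < m i.
Hypothesis c0 : forall N, 0 < c N.
Hypothesis hT : forall N j,
  T N j = P N j - \sum_(i < r.+1) m i * T N i * \sum_(k < N.+1) P k i * P k j.
Hypothesis hc : forall N, c N ^+ 2 = 1 - \sum_(i < r.+1) m i * T N i * P N i.

(* The low coefficients tend to 0 after [rescale]; [si] is the normalization in
   which their linear system has a nondegenerate limit. *)
Let si N (i : 'I_r.+1) : R :=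
  m i * T N i * ((-1) ^+ N / al N * b_ N ^+ (2 * i + e) * N%:R).
Let wi N (i : 'I_r.+1) : R := (m i * (W (2 * (i + i + e)) N * N%:R))^-1.

Let scaleT N j : (0 < N)%N ->
  scale N j (T N j) = pin N j - \sum_i si N i * ka N i j.
Proof.
move=> N0; have NR0 : N%:R != 0 :> R by rewrite pnatr_eq0 -lt0n.
rewrite hT /scale /rescale mulrBr mulrBl; congr (_ - _).
rewrite mulr_sumr mulr_suml; apply: eq_bigr => i _.
rewrite /si /ka /W; set S := \sum_(_ < _) _.
have -> : (2 * (i + j + e) = (2 * i + e) + (2 * j + e))%N by lia.
rewrite [b_ N ^+ (_ + e + _)]exprD; field.
by rewrite NR0 alN0 !bN0.
Qed.

Let si_scaleT N (i : 'I_r.+1) : (0 < N)%N -> scale N i (T N i) = si N i * wi N i.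
Proof.
move=> N0; have NR0 : N%:R != 0 :> R by rewrite pnatr_eq0 -lt0n.
rewrite /scale /rescale /si /wi /W.
have -> : (2 * (i + i + e) = (2 * i + e) + (2 * i + e))%N by lia.
rewrite [b_ N ^+ (_ + e + _)]exprD; field.
by rewrite NR0 alN0 !bN0 (gt_eqF (m0 i)).
Qed.

Let hc' N : (0 < N)%N -> c N ^+ 2 = 1 - N%:R^-1 * \sum_i si N i * pin N i.
Proof.
move=> N0; have NR0 : N%:R != 0 :> R by rewrite pnatr_eq0 -lt0n.
rewrite hc mulr_sumr; congr (_ - _); apply: eq_bigr => i _.
rewrite /si /pin /scale /rescale -[LHS]mul1r -[X in X * _ = _](sgn2 N); field.
by rewrite NR0 alN0 !bN0.
Qed.

Let wi_cvg i : (fun N => wi N i) @ \oo --> (0 : R).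
Proof.
have h : power_asymp (fun N => (W (2 * (i + i + e)) N * N%:R)^-1)
   (A ^+ 2 * B ^+ (2 * (i + i + e)))^-1 (- expo (i + i)).
  by apply: power_asympV; [rewrite mulf_neq0// expf_neq0// lt0r_neq0|exact: NW_asymp].
have := power_asymp_neg _ h; rewrite oppr_lt0 => /(_ (expo_gt0 _)) {}h.
rewrite -[X in _ --> X](mulr0 (m i)^-1).
rewrite (_ : (fun N => _) = (fun N => (m i)^-1 * (W (2 * (i + i + e)) N * N%:R)^-1)).
  exact: cvgMr.
by apply/funext => N; rewrite /wi invfM.
Qed.

Let Kmx : 'M[R]_r.+1 := \matrix_(i, j) (be i * be j / expo (i + j)).

Let Kmx_unit : Kmx \in unitmx.
Proof.
apply: (@cauchy_unitmx _ _ th th0 (fun i => be i / (2 * b)) be) => // [i|i j].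
  by rewrite mulf_neq0// invr_eq0 lt0r_neq0// mulr_gt0.
rewrite mxE /expo natrD addrA; field.
by rewrite !gt_eqF// ltr_wpDr// ltr_wpDr.
Qed.

Let y : 'rV[R]_r.+1 := (\row_j be j) *m invmx Kmx.

(** For [j <= r], the two expressions [scaleT] and [si_scaleT] of the same rescaled coefficient give
    a square system for [si]. Its matrix is [ka] plus the diagonal [wi], and the diagonal dies out
    in the limit. *)
Let si_cvg i : (fun N => si N i) @ \oo --> y 0 i.
Proof.
have -> : (fun N => si N i) = (fun N => (\row_j si N j) 0 i).
  by apply/funext => N; rewrite mxE.
apply: (@cvgn_linear_system _ _
  (fun N => \matrix_(i, j) (ka N i j + (i == j)%:R * wi N i)) Kmx _
  (fun N => \row_j pin N j) _ Kmx_unit) => [k l|j|].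
- rewrite (_ : (fun N => _) = (fun N => ka N k l + (k == l)%:R * wi N k)); last first.
    by apply/funext => N; rewrite mxE.
  rewrite mxE -[X in _ --> X]addr0; apply: cvgD; first exact: ka_cvg.
  by rewrite -[X in _ --> X](mulr0 (k == l)%:R); apply: cvgMr.
- rewrite (_ : (fun N => _) = (fun N => pin N j)); last first.
    by apply/funext => N; rewrite mxE.
  by rewrite mxE; exact: pin_cvg.
near=> N; have N0 : (0 < N)%N by near: N; exact: nbhs_infty_gt.
apply/rowP => j; rewrite !mxE; under eq_bigr do rewrite !mxE mulrDr.
rewrite big_split /=.
have -> : \sum_i si N i * ((i == j)%:R * wi N i) = si N j * wi N j.
  rewrite (bigD1 j)//= eqxx mul1r big1 ?addr0// => k /negbTE->.
  by rewrite mul0r mulr0.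
by rewrite -si_scaleT// scaleT// addrC subrK.
Unshelve. all: by end_near. Qed.

(** The system solved by [y] says that the partial fractions with residues [y i * be i / (2 * b)]
    equal 1 at [0, ..., r], so [cauchy_residual] evaluates them at every [j]. *)
Let limit_residual j : be j - \sum_i y 0 i * (be i * be j / expo (i + j))
  = be j * \prod_(l < r.+1) ((j%:R - l%:R) / (th + l%:R + j%:R)).
Proof.
have yK : y *m Kmx = \row_j be j by rewrite mulmxKV.
rewrite -(@cauchy_residual _ _ th th0 (fun i => y 0 i * be i / (2 * b)))//.
  rewrite mulrBr mulr1 mulr_sumr; congr (_ - _); apply: eq_bigr => i _.
  rewrite /expo natrD addrA; field.
  by rewrite !gt_eqF// ltr_wpDr// ltr_wpDr.
move=> k; have := congr1 (fun A : 'rV[R]_r.+1 => A 0 k) yK; rewrite !mxE => yKk.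
apply: (mulIf (be0 k)); rewrite mul1r -[RHS]yKk mulr_suml; apply: eq_bigr => i _.
rewrite [Kmx i k]mxE /expo natrD addrA; field.
by rewrite !gt_eqF// ltr_wpDr// ltr_wpDr.
Qed.

(** By [hc'], [c ^+ 2] differs from 1 by [N^-1] times a convergent sum, and [c > 0] gives
    [|1 - c| <= |1 - c ^+ 2|]. *)
Let c_cvg : c @ \oo --> (1 : R).
Proof.
have c2 : (fun N => c N ^+ 2) @ \oo --> (1 : R).
  apply: (@near_eq_cvgn _ (fun N => 1 - N%:R^-1 * \sum_i si N i * pin N i)).
    by near=> N; rewrite hc'//; near: N; exact: nbhs_infty_gt.
  rewrite -[X in _ --> X](subr0 1); apply: cvgB; first exact: cvg_cst.
  rewrite -[X in _ --> X](mul0r (\sum_i y 0 i * be i)); apply: cvgM.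
    by rewrite -cvg_shiftS; exact: cvg_harmonic.
  by apply: cvgn_sum => i _; apply: cvgM; [exact: si_cvg|exact: pin_cvg].
apply/cvgrPdist_le => eps eps0.
move/cvgrPdist_le : c2 => /(_ _ eps0); apply: filterS => N; apply: le_trans.
have -> : 1 - c N ^+ 2 = (1 - c N) * (1 + c N) by ring.
rewrite normrM ler_peMr// ger0_norm ?addr_ge0 ?(ltW (c0 N))//.
by rewrite lerDl ltW.
Unshelve. all: by end_near. Qed.

Lemma perturbed_coef_cvg j :
  (fun N => rescale al b_ e N j (T N j / c N)) @ \oo -->
    be j * \prod_(l < r.+1) ((j%:R - l%:R) / (th + l%:R + j%:R)).
Proof.
rewrite -limit_residual -[X in _ --> X]divr1.
apply: (@near_eq_cvgn _ (fun N => (pin N j - \sum_i si N i * ka N i j) / c N)).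
  near=> N; rewrite -scaleT /scale /rescale; last by near: N; exact: nbhs_infty_gt.
  by rewrite !mulrA mulrAC.
apply: cvgM; last by apply: cvgV; [exact: oner_neq0|exact: c_cvg].
apply: cvgB; first exact: pin_cvg.
by apply: cvgn_sum => i _; apply: cvgM; [exact: si_cvg|exact: ka_cvg].
Unshelve. all: by end_near. Qed.

Lemma perturbed_coef_bound rho : 1 <= rho -> exists K, \forall N \near \oo,
  forall j, `|rescale al b_ e N j (T N j / c N)| * rho ^+ j <= K.
Proof.
move=> rho1; have [K piK] := pin_bnd rho1.
have {}piK k j : `|pin k j| * rho ^+ j <= K by exact: piK.
have [L kaL] : exists L : 'I_r.+1 -> R, forall i : 'I_r.+1, \forall N \near \oo,
    forall j, `|ka N i j| * rho ^+ j <= L i.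
  by have [L LP] := choice (fun i : 'I_r.+1 => ka_bnd i rho1); exists L.
(* The factor 2 bounds [(c N)^-1], since [c N >= 1/2] eventually. *)
exists (2 * (K + \sum_i (`|y 0 i| + 1) * L i)); near=> N => j.
have N0 : (0 < N)%N by near: N; exact: nbhs_infty_gt.
have cN : c N >= 2^-1.
  have : `|1 - c N| <= 2^-1.
    by near: N; move/cvgrPdist_le : c_cvg; apply; rewrite invr_gt0.
  by rewrite ler_norml => /andP[_ h]; lra.
have siN : forall i, `|si N i| <= `|y 0 i| + 1.
  near: N; apply: filter_forall => i.
  move/cvgrPdist_le : (@si_cvg i) => /(_ _ ltr01); apply: filterS => N.
  by rewrite distrC => h; have := ler_normD (si N i - y 0 i) (y 0 i); rewrite subrK; lra.
have kaN : forall (i : 'I_r.+1) j, `|ka N i j| * rho ^+ j <= L i.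
  by near: N; apply: filter_forall.
have -> : rescale al b_ e N j (T N j / c N) = scale N j (T N j) / c N.
  by rewrite /scale /rescale !mulrA mulrAC.
have rj0 : 0 <= rho ^+ j by rewrite exprn_ge0// (le_trans _ rho1).
rewrite scaleT// normrM normfV (gtr0_norm (c0 N)) mulrAC mulrC.
apply: ler_pM; rewrite ?mulr_ge0 ?invr_ge0 ?(ltW (c0 N))//.
  by rewrite -[leRHS]invrK lef_pV2 ?posrE ?invr_gt0.
apply: le_trans (ler_wpM2r rj0 (ler_normB _ _)) _; rewrite mulrDl lerD//.
apply: le_trans (ler_wpM2r rj0 (ler_norm_sum _ _ _)) _.
rewrite mulr_suml; apply: ler_sum => i _; rewrite normrM -mulrA.
by apply: ler_pM => //; rewrite mulr_ge0.
Unshelve. all: by end_near. Qed.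

End perturbed_kernel.

(** * Orthonormal polynomials *)

Section orthonormal_polynomials.
Variable R : realType.
Implicit Types (ip : {poly R} -> {poly R} -> R) (p q : nat -> {poly R}).

Definition left_linear ip :=
  forall c (f g h : {poly R}), ip (c *: f + g) h = c * ip f h + ip g h.

Section theory.
Variables (ip : {poly R} -> {poly R} -> R) (p : nat -> {poly R}).
Hypothesis ip_lin : left_linear ip.
Hypothesis hp : orthonormal_polynomials ip p.

Lemma left_linear0 h : ip 0 h = 0.
Proof.
have := ip_lin 1 0 0 h; rewrite scaler0 add0r mul1r -[LHS]addr0.
by move/addrI.
Qed.

Lemma left_linearZ c f h : ip (c *: f) h = c * ip f h.
Proof. by have := ip_lin c f 0 h; rewrite addr0 left_linear0 addr0. Qed.

Lemma left_linear_sum I (s : seq I) (P : pred I) (a : I -> R) (f : I -> {poly R}) h :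
  ip (\sum_(i <- s | P i) a i *: f i) h = \sum_(i <- s | P i) a i * ip (f i) h.
Proof.
elim: s => [|i s IH]; first by rewrite !big_nil left_linear0.
by rewrite !big_cons; case: ifP => // _; rewrite ip_lin IH.
Qed.

Lemma size_sub_lead (f g : {poly R}) n : (size f <= n.+1)%N -> size g = n.+1 ->
  (size (f - (f`_n / lead_coef g) *: g)%R <= n)%N.
Proof.
move=> fn gn; apply/leq_sizeP => j nj; rewrite coefB coefZ.
have g0 : lead_coef g != 0 by rewrite lead_coef_eq0 -size_poly_eq0 gn.
move: nj; rewrite leq_eqVlt => /predU1P[<-|nj].
  by rewrite [g`_n](_ : _ = lead_coef g) ?divfK ?subrr// lead_coefE gn.
by rewrite [f`_j]nth_default ?(leq_trans fn)// [g`_j]nth_default ?gn// mulr0 subrr.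
Qed.

Lemma orthonormal_expansion n (f : {poly R}) : (size f <= n)%N ->
  f = \sum_(k < n) ip f (p k) *: p k.
Proof.
have [sp _ op] := hp.
elim: n f => [|n IH] f fn.
  by move: fn; rewrite leqn0 size_poly_eq0 => /eqP ->; rewrite big_ord0.
pose x := f`_n / lead_coef (p n); have gn := size_sub_lead fn (sp n).
set g := f - _ in gn.
have ipg k : ip f (p k) = x * (n == k)%:R + ip g (p k).
  have -> : f = x *: p n + g by rewrite /g /x addrC subrK.
  by rewrite ip_lin op.
have gpn : ip g (p n) = 0.
  rewrite [g]IH// left_linear_sum big1// => k _.
  by rewrite op (ltn_eqF (ltn_ord k)) mulr0.
rewrite big_ord_recr /= ipg eqxx mulr1 gpn addr0.
rewrite (eq_bigr (fun k : 'I_n => ip g (p k) *: p k)) => [|k _]; last first.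
  by rewrite ipg (gtn_eqF (ltn_ord k)) mulr0 add0r.
by rewrite -IH// /g subrK.
Qed.

Lemma orthonormal_low n (f : {poly R}) : (size f <= n)%N -> ip f (p n) = 0.
Proof.
move=> fn; have [_ _ op] := hp; rewrite (orthonormal_expansion fn) left_linear_sum.
by rewrite big1// => k _; rewrite op (ltn_eqF (ltn_ord k)) mulr0.
Qed.

Lemma orthonormal_lead n (f : {poly R}) : (size f <= n.+1)%N ->
  ip f (p n) = f`_n / lead_coef (p n).
Proof.
move=> fn; have [sp _ op] := hp; have gn := size_sub_lead fn (sp n).
rewrite -[f in LHS](subrK ((f`_n / lead_coef (p n)) *: p n)) addrC ip_lin.
by rewrite (orthonormal_low gn) op eqxx mulr1 addr0.
Qed.

End theory.

Lemma orthonormal_unique ip p q :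
  (forall f g, ip f g = ip g f) -> left_linear ip ->
  orthonormal_polynomials ip p -> orthonormal_polynomials ip q -> p =1 q.
Proof.
move=> ip_sym ip_lin hp hq n; have [sp lp op] := hp; have [sq lq oq] := hq.
pose c := lead_coef (q n) / lead_coef (p n).
have c0 : 0 < c by rewrite divr_gt0.
have qE : q n = c *: p n.
  rewrite {1}(@orthonormal_expansion _ _ ip_lin hp n.+1 (q n)) ?sq//.
  rewrite big_ord_recr /= big1 ?add0r => [|k _]; last first.
    by rewrite ip_sym (orthonormal_low ip_lin hq) ?scale0r// sp.
  by rewrite (orthonormal_lead ip_lin hp) ?sq// /c [lead_coef (q n)]lead_coefE sq.
have : c ^+ 2 = 1.
  have := oq n n; rewrite eqxx qE (left_linearZ ip_lin) ip_sym.
  by rewrite (left_linearZ ip_lin) op eqxx mulr1.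
move=> /eqP; rewrite sqrf_eq1 => /orP[/eqP c1|/eqP cN1].
  by rewrite qE c1 scale1r.
by move: c0; rewrite cN1 oppr_gt0 ltr10.
Qed.

Lemma derivn_at0 (f : {poly R}) i : f^`(i).[0] = i`!%:R * f`_i.
Proof. by rewrite horner_coef0 coef_derivn addn0 ffactnn mulr_natl. Qed.

Definition perturb ip n (M : nat -> R) (f g : {poly R}) : R :=
  ip f g + \sum_(i < n) M i * f^`(i).[0] * g^`(i).[0].

Lemma perturb_sym ip n M : (forall f g, ip f g = ip g f) ->
  forall f g, perturb ip n M f g = perturb ip n M g f.
Proof.
by move=> ips f g; rewrite /perturb ips; congr (_ + _); apply: eq_bigr => i _;
  rewrite mulrAC.
Qed.

Lemma perturb_lin ip n M : left_linear ip -> left_linear (perturb ip n M).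
Proof.
move=> ipl c f g h; rewrite /perturb ipl mulrDr addrACA; congr (_ + _).
rewrite mulr_sumr -big_split; apply: eq_bigr => i _ /=.
by rewrite !derivn_at0 coefD coefZ; ring.
Qed.

(** The perturbed product of [q n] with [p k] is 0 for [k < n] and [c^-1] for [k = n]. Removing the
    point masses gives the Fourier coefficients of [c q_n] in the [p k]; the one at [k = n] equals
    [c ^+ 2]. *)
Lemma perturbed_expansion ip p q s (M : nat -> R) n :
  (forall f g, ip f g = ip g f) -> left_linear ip ->
  orthonormal_polynomials ip p -> orthonormal_polynomials (perturb ip s M) q ->
  let c := lead_coef (q n) / lead_coef (p n) in
  let m i := M i * i`!%:R ^+ 2 in
  (forall j, c * (q n)`_j = (p n)`_j -
     \sum_(i < s) m i * (c * (q n)`_i) * \sum_(k < n.+1) (p k)`_i * (p k)`_j) /\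
  c ^+ 2 = 1 - \sum_(i < s) m i * (c * (q n)`_i) * (p n)`_i.
Proof.
move=> ips ipl hp hq c m; have [sp lp op] := hp; have [sq lq oq] := hq.
have ql := perturb_lin s M ipl.
have pl : (p n)`_n = lead_coef (p n) by rewrite lead_coefE sp.
have ql' : (q n)`_n = lead_coef (q n) by rewrite lead_coefE sq.
have ipq k : (k <= n)%N ->
    c * ip (q n) (p k) = (n == k)%:R - \sum_(i < s) m i * (c * (q n)`_i) * (p k)`_i.
  move=> kn; have -> : ip (q n) (p k) = perturb ip s M (q n) (p k) -
      \sum_(i < s) m i * (q n)`_i * (p k)`_i.
    rewrite /perturb -addrA -[LHS]addr0; congr (_ + _); rewrite -sumrB big1// => i _.
    by rewrite !derivn_at0 /m; ring.
  rewrite mulrBr mulr_sumr; congr (_ - _); last by apply: eq_bigr => i _; ring.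
  rewrite (perturb_sym s M ips) (orthonormal_lead ql hq); last by rewrite sp.
  have [<-|nk] := eqVneq n k.
    by rewrite pl /c -[RHS]/(1 : R); field; rewrite !gt_eqF.
  by rewrite nth_default ?mul0r ?mulr0// sp ltn_neqAle eq_sym nk.
split.
- move=> j; rewrite {1}(orthonormal_expansion ipl hp (n := n.+1) (f := q n)) ?sq//.
  rewrite coef_sum mulr_sumr.
  rewrite (eq_bigr (fun k : 'I_n.+1 => (n == k)%:R * (p k)`_j -
      \sum_(i < s) m i * (c * (q n)`_i) * ((p k)`_i * (p k)`_j))); last first.
    move=> k _; rewrite coefZ mulrA (ipq _ (ltn_ord k : (k <= n)%N)) mulrBl mulr_suml;
      congr (_ - _).
    by apply: eq_bigr => i _; ring.
  rewrite sumrB; congr (_ - _).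
    rewrite big_ord_recr /= eqxx mul1r big1 ?add0r// => k _.
    by rewrite gtn_eqF// mul0r.
  by rewrite exchange_big /=; apply: eq_bigr => i _; rewrite mulr_sumr.
- have := ipq n (leqnn n); rewrite eqxx -[true%:R]/(1 : R) => <-.
  rewrite (orthonormal_lead ipl hp) ?sq//.
  by rewrite ql' expr2.
Qed.

Definition reflect_poly (f : {poly R}) : {poly R} :=
  \poly_(k < size f) ((-1) ^+ k * f`_k).

Lemma coef_reflect_poly f k : (reflect_poly f)`_k = (-1) ^+ k * f`_k.
Proof.
by rewrite coef_poly; case: ltnP => // fk; rewrite nth_default ?mulr0.
Qed.

Lemma size_reflect_poly f : size (reflect_poly f) = size f.
Proof.
have [->|f0] := eqVneq f 0; first by rewrite /reflect_poly size_poly0 poly_def big_ord0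
  size_poly0.
apply: size_poly_eq; rewrite mulf_neq0 ?expf_neq0 ?oppr_eq0 ?oner_neq0//.
by rewrite -lead_coefE lead_coef_eq0.
Qed.

Lemma horner_reflect_poly f x : (reflect_poly f).[x] = f.[- x].
Proof.
rewrite horner_poly horner_coef; apply: eq_bigr => k _.
by rewrite [(- x) ^+ k]exprNn mulrCA mulrA.
Qed.

(** The polynomials [(-1)^n p_n(-x)] are orthonormal for the same reflection-invariant product, so
    uniqueness identifies them with [p_n]. *)
Lemma orthonormal_parity ip p :
  (forall f g, ip f g = ip g f) -> left_linear ip ->
  (forall f g, ip (reflect_poly f) (reflect_poly g) = ip f g) ->
  orthonormal_polynomials ip p ->
  forall n k, odd k != odd n -> (p n)`_k = 0.
Proof.
move=> ips ipl ipr hp n k kn; have [sp lp op] := hp.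
have sg0 i : (-1) ^+ i != 0 :> R by rewrite expf_neq0// oppr_eq0 oner_neq0.
have hr : orthonormal_polynomials ip (fun n => (-1) ^+ n *: reflect_poly (p n)).
  split=> [i|i|i j].
  - by rewrite size_scale// size_reflect_poly.
  - rewrite lead_coefZ lead_coefE size_reflect_poly coef_reflect_poly sp /= mulrA.
    rewrite -expr2 sqrr_sign mul1r.
    by have := lp i; rewrite lead_coefE sp.
  - rewrite (left_linearZ ipl) ips (left_linearZ ipl) ipr ips op.
    have [<-|ij] := eqVneq i j; last by rewrite !mulr0.
    by rewrite mulr1 -expr2 sqrr_sign.
have := congr1 (fun f : {poly R} => f`_k) (orthonormal_unique ips ipl hp hr n).
rewrite /= coefZ coef_reflect_poly mulrA -exprD -signr_odd oddD.
have -> : odd n (+) odd k = true by move: kn; case: (odd n); case: (odd k).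
rewrite expr1 mulN1r => /eqP; rewrite -addr_eq0 -mulr2n mulrn_eq0 /=.
by move/eqP.
Qed.

End orthonormal_polynomials.

(** * The inner product of a symmetric measure with finite moments *)

Section moments.
Variables (R : realType) (mu : {finite_measure set (measurableTypeR R) -> \bar R}).
Hypothesis hmom : finite_moments mu.

Lemma integrable_horner (f : {poly R}) :
  mu.-integrable setT (fun x : measurableTypeR R => (f.[x])%:E).
Proof.
have H : mu.-integrable setT (fun x : measurableTypeR R =>
    \sum_(i < size f) (f`_i)%:E * (x ^+ i)%:E)%E.
  by apply: integrable_sum => // i _; apply: integrableZl => //; exact: hmom.
apply: eq_integrable H => // x _.
by rewrite horner_coef -sumEFin; apply: eq_bigr => i _; rewrite EFinM.
Qed.

Lemma inner_mu_sym f g : inner_mu mu f g = inner_mu mu g f.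
Proof. by apply: eq_Rintegral => x _; rewrite mulrC. Qed.

Lemma inner_mu_lin : left_linear (inner_mu mu).
Proof.
move=> c f g h; rewrite /inner_mu.
have iM u v : mu.-integrable setT (EFin \o (fun x : measurableTypeR R => u.[x] * v.[x])).
  apply: eq_integrable (integrable_horner (u * v)) => // x _.
  by rewrite /= hornerM.
have ic : mu.-integrable setT (EFin \o (fun x : measurableTypeR R => c * (f.[x] *
  h.[x]))).
  by apply: (integrableZl _ c (iM f h)).
transitivity (\int[mu]_(x in setT) (c * (f.[x] * h.[x]) + g.[x] * h.[x])).
  by apply: eq_Rintegral => x _; rewrite hornerD hornerZ; ring.
by rewrite RintegralD// RintegralZl.
Qed.

(** Symmetry says that [mu] equals its image under negation, so this is a change of variables. *)
Lemma inner_mu_reflect f g : symmetric_measure mu ->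
  inner_mu mu (reflect_poly f) (reflect_poly g) = inner_mu mu f g.
Proof.
move=> hsym; rewrite /inner_mu /Rintegral; congr fine.
pose phi : measurableTypeR R -> measurableTypeR R := fun x => - x.
have mphi : measurable_fun setT phi by apply: measurable_realfun.measurable_funN;
  exact: measurable_id.
transitivity (\int[pushforward mu phi]_(x in setT) (f.[x] * g.[x])%:E)%E; last first.
  by apply: eq_measure_integral => A mA _; exact: hsym.
rewrite integral_pushforward//=.
- by rewrite preimage_setT; apply: eq_integral => x _ /=; rewrite !horner_reflect_poly.
- rewrite (_ : (fun y => _) = (fun y : measurableTypeR R => ((f * g).[y])%:E)).
    exact: measurable_int (integrable_horner (f * g)).
  by apply/funext => y; rewrite hornerM.
- rewrite preimage_setT.
  apply: eq_integrable (integrable_horner (reflect_poly f * reflect_poly g)) => // y _.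
  by rewrite /= hornerM !horner_reflect_poly.
Qed.

End moments.

(** * Bessel coefficients *)

Section bessel_coefficients.
Variable R : realType.
Implicit Types (nu s rho : R).

Definition bessel_coef nu (m n : nat) : R :=
  (-1) ^+ n / (n`!%:R * Gamma (n%:R + nu + m%:R + 1)).

Lemma scaled_besselE nu m : scaled_bessel nu m = power_sum (bessel_coef nu m) m.
Proof.
apply/funext => z; rewrite /scaled_bessel /power_sum.
rewrite (_ : (fun n => _) = (fun n => (bessel_coef nu m n)%:C * z ^+ (2 * n + m) :
  R[i]^o))//.
apply/funext => n; rewrite /bessel_coef fmorph_div rmorphXn rmorphN1.
by rewrite mulrAC.
Qed.

Lemma bessel_coef_neq0 nu m n : -1 < nu -> bessel_coef nu m n != 0.
Proof.
move=> nu1; rewrite mulf_neq0 ?expf_neq0 ?oppr_eq0 ?oner_neq0// invr_eq0.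
rewrite mulf_neq0 ?pnatr_eq0 -?lt0n ?fact_gt0// gt_eqF// Gamma_gt0//.
have := ler0n R n; have := ler0n R m; lra.
Qed.

Lemma bessel_coef_rapid nu m : -1 < nu -> rapidly_decreasing (bessel_coef nu m).
Proof.
move=> nu1 rho rho1; pose t := nu + m%:R + 1.
have t0 : 0 < t by have := ler0n R m; rewrite /t; lra.
have G0 := Gamma_gt0 t0.
have tn n : n%:R + nu + m%:R + 1 = n%:R + t by rewrite /t; ring.
exists ((Gamma t)^-1 * expR (rho / t)) => n.
have rho0 : 0 <= rho by exact: le_trans rho1.
have x0 : 0 <= rho / t by rewrite divr_ge0// ltW.
have Gn : t ^+ n * Gamma t <= Gamma (n%:R + t).
  rewrite Gamma_rising// ler_wpM2r ?(ltW G0)//.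
  rewrite -[X in t ^+ X](card_ord n) -prodr_const; apply: ler_prod => l _.
  by rewrite (ltW t0) /= lerDl ler0n.
have tnG : 0 < t ^+ n * Gamma t by exact: mulr_gt0 (exprn_gt0 n t0) G0.
have n0 : 0 < n`!%:R :> R by rewrite ltr0n fact_gt0.
have e1 : (rho / t) ^+ n / n`!%:R <= expR (rho / t).
  case: n {Gn tnG n0} => [|n].
    by rewrite expr0 divr1; apply: le_trans (expR_ge1Dx _); rewrite lerDl.
  by apply: le_trans (expR_ge1Dxn n x0); rewrite lerDr.
apply: le_trans (ler_wpM2l _ e1); last by rewrite invr_ge0 (ltW G0).
rewrite /bessel_coef tn normrM normrX normrN1 expr1n mul1r normfV.
rewrite (gtr0_norm (mulr_gt0 n0 (lt_le_trans tnG Gn))).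
have -> : (Gamma t)^-1 * ((rho / t) ^+ n / n`!%:R)
    = (n`!%:R * (t ^+ n * Gamma t))^-1 * rho ^+ n.
  by rewrite expr_div_n; field; rewrite (gt_eqF n0) (gt_eqF G0) expf_neq0 ?gt_eqF.
rewrite ler_wpM2r ?exprn_ge0//.
have GG := lt_le_trans tnG Gn.
rewrite lef_pV2 ?posrE; [by rewrite ler_pM2l|exact: mulr_gt0|exact: mulr_gt0].
Qed.

(** The numerators form the falling factorial that reduces [(k + n)!] to [k!]; the denominators form
    the rising factorial that raises the argument of [Gamma] by [n]. *)
Lemma bessel_coef_shift nu m n k : -1 < nu ->
  bessel_coef nu m (k + n) *
    \prod_(l < n) (((k + n)%:R - l%:R) / ((nu + m%:R + 1) + l%:R + (k + n)%:R))
  = (-1) ^+ n * bessel_coef nu (2 * n + m) k.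
Proof.
move=> nu1; set t := nu + m%:R + 1.
have t0 : 0 < t by have := ler0n R m; rewrite /t; lra.
pose s := (k + n)%:R + t.
have s0 : 0 < s by rewrite ltr_wpDl.
rewrite prodf_div /bessel_coef.
have -> : (k + n)%:R + nu + m%:R + 1 = s by rewrite /s /t; ring.
have -> : k%:R + nu + (2 * n + m)%:R + 1 = n%:R + s.
  by rewrite /s /t [(2 * n + m)%:R]natrD natrM [(k + n)%:R]natrD; ring.
rewrite Gamma_rising//.
have -> : \prod_(l < n) (t + l%:R + (k + n)%:R) = \prod_(l < n) (s + l%:R).
  by apply: eq_bigr => l _; rewrite /s; ring.
set Q := \prod_(l < n) (s + l%:R).
have Q0 : Q != 0.
  by apply/prodf_neq0 => l _; rewrite gt_eqF// ltr_pwDl ?ler0n.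
have -> : \prod_(l < n) ((k + n)%:R - l%:R) = ((k + n) ^_ n)%:R :> R.
  rewrite ffact_prod natr_prod; apply: eq_bigr => l _.
  by rewrite natrB// (leq_trans (ltnW (ltn_ord l)))// leq_addl.
have -> : (k + n)`! = ((k + n) ^_ n * k`!)%N.
  by have := ffact_fact (leq_addl k n); rewrite addnK.
rewrite natrM exprD; field.
rewrite Q0 (gt_eqF (Gamma_gt0 s0)) !pnatr_eq0 -!lt0n fact_gt0 ffact_gt0.
by rewrite leq_addl.
Qed.

(** Dropping [n] vanishing terms turns the exponent [2 * (k + n) + m] into [2 * k + (2 * n + m)]: a
    shift of index becomes a rise of the order by [2 * n]. *)
Lemma power_sum_shift (c c' : nat -> R) (n m : nat) (x : R) z :
  rapidly_decreasing c' ->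
  (forall j, (j < n)%N -> c j = 0) -> (forall k, c (k + n)%N = x * c' k) ->
  power_sum c m z = x%:C * power_sum c' (2 * n + m) z.
Proof.
move=> c'r c0 cS; have rho1 : 1 <= 1 + complex.Re `|z| .
  by rewrite lerDl -lecR normc_def /= lecR sqrtr_ge0.
have zr : `|z| <= (1 + complex.Re `|z|)%:C.
  by rewrite [X in X <= _]normc_def normc_def /= lecR lerDr.
have [K /(_ z zr) [cv _]] := power_sum_tail (2 * n + m) c'r rho1.
apply: (@cvg_lim _ (@norm_hausdorff _ (R[i]^o : normedModType R[i]))).
rewrite -(cvg_shiftn n).
have -> : (fun T => series (fun j => (c j)%:C * z ^+ (2 * j + m)) (T + n)%N)
   = (fun T => x%:C * series (fun j => (c' j)%:C * z ^+ (2 * j + (2 * n + m))) T).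
  apply/funext => T; rewrite /series /= addnC.
  rewrite (big_cat_nat (leq0n n) (leq_addr T n))/=.
  rewrite [X in X + _]big_nat_cond big1 ?add0r => [|j /andP[/andP[_ jn] _]]; last first.
    by rewrite c0// realC0 mul0r.
  rewrite -[X in \sum_(X <= _ < _) _]add0n big_addn addKn mulr_sumr.
  apply: eq_bigr => j _; rewrite cS rmorphM -mulrA; congr (_ * (_ * z ^+ _)); lia.
by apply: cvgM; [exact: cvg_cst|exact: cv].
Qed.

End bessel_coefficients.

(** * Reduction to one parity class *)

Lemma sum_same_parity (V : nmodType) (e : bool) n (f : nat -> V) :
  (forall i, odd i != e -> f i = 0) ->
  \sum_(i < 2 * n) f i = \sum_(l < n) f (2 * l + e)%N.
Proof.
move=> f0; elim: n => [|n IH]; first by rewrite muln0 !big_ord0.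
rewrite mulnS add2n !big_ord_recr /= IH -addrA; congr (_ + _).
case: e f0 {IH} => f0.
  by rewrite (f0 (2 * n)%N) ?add0r ?addn1// mul2n odd_double.
by rewrite (f0 (2 * n).+1) ?addr0 ?addn0//= mul2n odd_double.
Qed.

Lemma sum_same_parityS (V : nmodType) (e : bool) n (f : nat -> V) :
  (forall i, odd i != e -> f i = 0) ->
  \sum_(i < (2 * n + e).+1) f i = \sum_(l < n.+1) f (2 * l + e)%N.
Proof.
move=> f0; rewrite -sum_same_parity// mulnS add2n.
case: e f0 => f0; first by rewrite addn1.
by rewrite addn0 [RHS]big_ord_recr /= f0 ?addr0//= mul2n odd_double.
Qed.

Section parity_class.
Variable R : realType.

Definition scale_poly (f : {poly R}) (x y : R) : {poly R} :=
  \poly_(k < size f) (x * f`_k / y ^+ k).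

Lemma coef_scale_poly f x y k : (scale_poly f x y)`_k = x * f`_k / y ^+ k.
Proof.
by rewrite coef_poly; case: ltnP => // fk; rewrite nth_default// mulr0 mul0r.
Qed.

Lemma scaled_polyE (a_ b_ : nat -> R) (p : nat -> {poly R}) n z :
  scaled_poly a_ b_ p n z
    = poly_evalC (scale_poly (p n) ((-1) ^+ n * Num.sqrt (a_ n)) (b_ n)) z.
Proof.
rewrite /scaled_poly /poly_evalC; move: ((-1) ^+ n * Num.sqrt (a_ n)) => x.
rewrite (horner_coef_wide (n := size (p n)) z) ?(leq_trans (size_poly _ _)) ?size_poly//.
rewrite (horner_coef_wide (n := size (p n)) (z / (b_ n)%:C)) ?size_poly// mulr_sumr.
apply: eq_bigr => k _; rewrite !coef_map coef_scale_poly /=.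
by rewrite exprMn exprVn fmorph_div rmorphM rmorphXn; ring.
Qed.

Variables (mu : {finite_measure set (measurableTypeR R) -> \bar R}).
Variables (p q : nat -> {poly R}) (r : nat) (M : 'I_(2 * r + 2) -> R).
Variables (a_ b_ : nat -> R) (a A b B nu : R) (e : bool).
Hypotheses (hmom : finite_moments mu) (hsym : symmetric_measure mu).
Hypothesis hM : forall i, 0 < M i.
Hypothesis hp : orthonormal_polynomials (inner_mu mu) p.
Hypothesis hq : orthonormal_polynomials (inner_sobolev mu M) q.
Hypotheses (ha_ : forall n, 0 < a_ n) (hb_ : forall n, 0 < b_ n).
Hypotheses (hA : 0 < A) (hB : 0 < B) (hb : 0 < b).
Hypothesis ha_asymp :
  asymp_equiv (fun n => (Num.sqrt (a_ n))^-1) (fun n => A * n%:R `^ a).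
Hypothesis hb_asymp : asymp_equiv b_ (fun n => B * n%:R `^ b).
Hypotheses (hnu : -1 < nu) (hab : 2 * a + 1 = 2 * b * (nu + 1)).

(** The masses extended to all naturals, so that they can be indexed by [2 * i + e]; the default 1
    keeps them positive. *)
Let M' (i : nat) : R := odflt 1 (omap M (insub i)).

Let inner_sobolevE : inner_sobolev mu M = perturb (inner_mu mu) (2 * r + 2) M'.
Proof.
apply/funext => f; apply/funext => g; rewrite /inner_sobolev /perturb; congr (_ + _).
by apply: eq_bigr => i _; rewrite /M' valK.
Qed.

Let M'_gt0 i : 0 < M' i.
Proof. by rewrite /M'; case: insub => //= i'. Qed.

Let ips := inner_mu_sym mu.
Let ipl := inner_mu_lin hmom.

Let p_parity := orthonormal_parity ips ipl (fun f g => inner_mu_reflect hmom f g hsym) hp.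

Let hq' : orthonormal_polynomials (perturb (inner_mu mu) (2 * r + 2) M') q.
Proof. by rewrite -inner_sobolevE. Qed.

Let q_parity n k : odd k != odd n -> (q n)`_k = 0.
Proof.
apply: (orthonormal_parity (perturb_sym _ M' ips) (perturb_lin _ M' ipl) _ hq') => f g.
rewrite /perturb inner_mu_reflect//; congr (_ + _); apply: eq_bigr => i _.
rewrite !derivn_at0 !coef_reflect_poly.
have s2 : (-1) ^+ i * (-1) ^+ i = 1 :> R by rewrite -expr2 sqrr_sign.
by rewrite -[RHS]mul1r -[X in _ = X * _]s2; ring.
Qed.

Let idx n := (2 * n + e)%N.
Let odd_idx n : odd (idx n) = e.
Proof. by rewrite /idx oddD mul2n odd_double; case: e. Qed.

Let c N : R := lead_coef (q (idx N)) / lead_coef (p (idx N)).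
Let c_gt0 N : 0 < c N.
Proof. by have [_ lp _] := hp; have [_ lq _] := hq; rewrite divr_gt0. Qed.

Let P N j : R := (p (idx N))`_(idx j).
(** With the factor [c N], the inhomogeneous term of the expansion [hT] is exactly [P N j]. *)
Let T N j : R := c N * (q (idx N))`_(idx j).
Let m (i : 'I_r.+1) : R := M' (idx i) * (idx i)`!%:R ^+ 2.

Let kernel_sum N i j : \sum_(k < (idx N).+1) (p k)`_(idx i) * (p k)`_(idx j)
  = \sum_(k < N.+1) P k i * P k j.
Proof.
have f0 k : odd k != e -> (p k)`_(idx i) * (p k)`_(idx j) = 0.
  by move=> ke; rewrite p_parity ?mul0r// odd_idx eq_sym.
exact: sum_same_parityS f0.
Qed.

(** Only the orders of the parity of [q (idx N)] contribute, so [2 * r + 2] masses leave [r + 1]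
    unknowns. *)
Let perturbation_sum N (f : nat -> R) (g : nat -> R) :
  \sum_(i < 2 * r + 2) M' i * i`!%:R ^+ 2 * (c N * (q (idx N))`_i) * f i
  = \sum_(i < r.+1) m i * T N i * f (idx i).
Proof.
have f0 i : odd i != e -> M' i * i`!%:R ^+ 2 * (c N * (q (idx N))`_i) * f i = 0.
  by move=> ie; rewrite q_parity ?mulr0 ?mul0r// odd_idx.
by rewrite -mulnSr (sum_same_parity _ f0).
Qed.

Let hT N j :
  T N j = P N j - \sum_(i < r.+1) m i * T N i * \sum_(k < N.+1) P k i * P k j.
Proof.
have [/(_ (idx j)) H _] := perturbed_expansion (idx N) ips ipl hp hq'.
rewrite [LHS]H.
rewrite -/(P N j); congr (_ - _).
under [RHS]eq_bigr => i _ do rewrite -kernel_sum.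
exact: (perturbation_sum N (fun i => \sum_(k < (idx N).+1) (p k)`_i * (p k)`_(idx j))).
Qed.

Let hc N : c N ^+ 2 = 1 - \sum_(i < r.+1) m i * T N i * P N i.
Proof.
have [_ H] := perturbed_expansion (idx N) ips ipl hp hq'.
rewrite [LHS]H; congr (_ - _).
exact: (perturbation_sum N (fun i => (p (idx N))`_i)).
Qed.

Let al n := Num.sqrt (a_ n).
Let al_gt0 n : 0 < al n. Proof. by rewrite sqrtr_gt0. Qed.

Let coef_scale f N j :
  (scale_poly f ((-1) ^+ N * al N) (b_ N))`_(2 * j + e) = rescale al b_ e N j f`_(idx j).
Proof. by rewrite coef_scale_poly. Qed.

Let be j : R := bessel_coef nu e j.
Let th : R := nu + e%:R + 1.

(** The boolean [e], read as 0 or 1, treats both parities at once: the hypothesis is turned into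
    coefficient limits and bounds, which pass to [q] and are reassembled into uniform
    convergence. *)
Lemma perturbed_parity_class :
  cvg_uniform_on_compacts (scaled_poly a_ b_ (fun n => p (2 * n + e)%N))
    (scaled_bessel nu e) ->
  cvg_uniform_on_compacts (scaled_poly a_ b_ (fun n => q (2 * n + e)%N))
    (fun z => (-1) ^+ r.+1 * scaled_bessel nu (2 * r.+1 + e) z).
Proof.
rewrite scaled_besselE => hpe.
pose F (f : nat -> {poly R}) n := scale_poly (f (idx n)) ((-1) ^+ n * al n) (b_ n).
have FE f : scaled_poly a_ b_ (fun n => f (2 * n + e)%N) = fun n => poly_evalC (F f n).
  by apply/funext => n; apply/funext => z; rewrite scaled_polyE.
rewrite FE in hpe; rewrite FE.
have th0 : 0 < th by rewrite /th addrAC ltr_wpDr// -ltrBlDr sub0r.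
have rapid : rapidly_decreasing be by exact: bessel_coef_rapid.
have P_cvg j : (fun N => rescale al b_ e N j (P N j)) @ \oo --> be j.
  apply: (near_eq_cvgn _ (coef_cvg_of_uniform (j := j) rapid hpe)); apply: nearW => N.
  by rewrite coef_scale.
have P_bnd rho : 1 <= rho ->
    exists K, forall N j, `|rescale al b_ e N j (P N j)| * rho ^+ j <= K.
  move=> /(coef_bound_of_uniform rapid) /(_ hpe)[K FK]; exists K => N j.
  by have := FK N j; rewrite coef_scale.
have be0 j : be j != 0 by exact: bessel_coef_neq0.
have m_gt0 i : 0 < m i by rewrite mulr_gt0// exprn_gt0// ltr0n fact_gt0.
have hal := asymp_equiv_power hA ha_asymp.
have hbb := asymp_equiv_power hB hb_asymp.
have hab' : 2 * a + 1 + 2 * b * e%:R = 2 * b * th by rewrite hab /th; ring.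
have Q_cvg := perturbed_coef_cvg al_gt0 hb_ hA hB hb th0 hal hbb hab'
  P_cvg be0 m_gt0 c_gt0 hT hc.
have Q_bnd := perturbed_coef_bound al_gt0 hb_ hA hB hb th0 hal hbb hab'
  P_cvg P_bnd be0 m_gt0 c_gt0 hT hc.
have TE N j : T N j / c N = (q (idx N))`_(idx j).
  by rewrite /T mulrAC divff ?mul1r// gt_eqF.
pose lim j := be j * \prod_(l < r.+1) ((j%:R - l%:R) / (th + l%:R + j%:R)).
have lim_rapid : rapidly_decreasing lim.
  move=> rho rho1; have [K beK] := rapid rho rho1; exists K => j.
  apply: le_trans (beK j); rewrite ler_wpM2r ?exprn_ge0 ?(le_trans _ rho1)//.
  (* Each factor satisfies [|j - l| <= th + l + j], so the product only decreases the rapidly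
     decreasing [be j]. *)
  rewrite normrM ler_piMr// normr_prod; apply: prodr_ile1 => l _; rewrite normr_ge0 /=.
  have d0 : 0 < th + l%:R + j%:R by rewrite ltr_wpDr// ltr_wpDr.
  rewrite normrM normfV (gtr0_norm d0) ler_pdivrMr// mul1r.
  have := ler_normB (j%:R : R) l%:R; rewrite !normr_nat => h.
  by apply: le_trans h _; rewrite -addrA [l%:R + _]addrC lerDr ltW.
suff -> : (fun z => (-1) ^+ r.+1 * scaled_bessel nu (2 * r.+1 + e) z) = power_sum lim e.
  apply: uniform_of_coef_cvg => //.
  - move=> n k kn; rewrite coef_scale_poly q_parity ?mulr0 ?mul0r//.
    rewrite odd_idx; move: kn; case: (e) => //=.
      by rewrite ltnS leqn0 => /orP[/eqP->|].
  - move=> j; apply: (near_eq_cvgn _ (Q_cvg j)); apply: nearW => N.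
    by rewrite coef_scale TE.
  - move=> rho rho1; have [K QK] := Q_bnd rho rho1; exists K.
    apply: filterS QK => N QN j; have := QN j.
    by rewrite coef_scale TE.
apply/funext => z; rewrite scaled_besselE.
rewrite (@power_sum_shift _ lim (bessel_coef nu (2 * r.+1 + e)) r.+1 e ((-1) ^+ r.+1)).
- by rewrite rmorphXn rmorphN1.
- exact: bessel_coef_rapid.
(* For [j <= r] the factor [l = j] of the product is zero; this removes the first [r + 1]
   coefficients. *)
- move=> j jr; rewrite /lim (bigD1 (Ordinal jr))//= subrr !mul0r mulr0//.
- by move=> k; exact: bessel_coef_shift.
Qed.

End parity_class.

(** * Both parity classes together *)

Theorem theorem6 (R : realType) (d : \bar R)
    (mu : {finite_measure set (measurableTypeR R) -> \bar R})
    (p q : nat -> {poly R}) (r : nat) (M : 'I_(2 * r + 2) -> R)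
    (a_ b_ : nat -> R) (a A b B nu : R)
    (hd : (0 < d)%E)
    (hmu : carried_by_interval d mu)
    (hmom : finite_moments mu)
    (hsym : symmetric_measure mu)
    (hsupp : infinite_set (measure_support mu))
    (hM : forall i, 0 < M i)
    (hp : orthonormal_polynomials (inner_mu mu) p)
    (hq : orthonormal_polynomials (inner_sobolev mu M) q)
    (ha_ : forall n, 0 < a_ n) (hb_ : forall n, 0 < b_ n)
    (hA : 0 < A) (hB : 0 < B) (hb : 0 < b)
    (ha_asymp : asymp_equiv (fun n => (Num.sqrt (a_ n))^-1)
                            (fun n => A * n%:R `^ a))
    (hb_asymp : asymp_equiv b_ (fun n => B * n%:R `^ b))
    (hnu : -1 < nu)
    (hab : 2 * a + 1 = 2 * b * (nu + 1))
    (hp_even : cvg_uniform_on_compacts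
       (scaled_poly a_ b_ (fun n => p (2 * n)%N))
       (scaled_bessel nu 0))
    (hp_odd : cvg_uniform_on_compacts
       (scaled_poly a_ b_ (fun n => p (2 * n + 1)%N))
       (scaled_bessel nu 1))
    (hgamma_even :
       (fun n => lead_coef (p (2 * n)%N) / lead_coef (p (2 * n + 1)%N)
                 * (b_ n / n%:R)) @ \oo --> 1 / (2 * b))
    (hgamma_odd :
       (fun n => lead_coef (p (2 * n + 1)%N) / lead_coef (p (2 * n + 2)%N)
                 * (b_ n / n%:R)) @ \oo --> 1 / (2 * b)) :
  cvg_uniform_on_compacts
    (scaled_poly a_ b_ (fun n => q (2 * n)%N))
    (fun z => (-1) ^+ r.+1 * scaled_bessel nu (2 * r + 2) z)
  /\ cvg_uniform_on_compacts
    (scaled_poly a_ b_ (fun n => q (2 * n + 1)%N))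
    (fun z => (-1) ^+ r.+1 * scaled_bessel nu (2 * r + 3) z).
Proof.
have even_idx (f : nat -> {poly R}) :
    (fun n => f (2 * n + false)%N) = (fun n => f (2 * n)%N).
  by apply/funext => n; rewrite addn0.
have H := perturbed_parity_class hmom hsym hM hp hq ha_ hb_ hA hB hb
  ha_asymp hb_asymp hnu hab.
have r2 : (2 * r.+1 = 2 * r + 2)%N by rewrite mulnSr.
split.
- have H0 := H false; rewrite !even_idx r2 -[nat_of_bool false]/0%N addn0 in H0.
  exact: H0 hp_even.
- have H1 := H true; rewrite r2 -[nat_of_bool true]/1%N -addnA in H1.
  exact: H1 hp_odd.
Qed.
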